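(* Let $X$ be a finite set of points in $\mathbb{R}^2$, let $T$ be a minimum spanning tree on $X$ with respect to a norm $\|\cdot\|$ on $\mathbb{R}^2$, let $k$ be a positive integer, and assume that the preprocessing steps PP1 and PP2 (see context) have been performed on $T$. If $F$ is a viable forest (not necessarily connected), then Algorithm $F$-MST, the specific procedure written out in the context, correctly produces a minimum $F$-fixed spanning tree $T_F$ in at most $O(k^{2k+3}\,k!)$ time.
   Context: All lengths are with respect to the given norm $\|\cdot\|$ on $\mathbb{R}^2$; the length of an edge $e$ is written $\|e\|$, and the total length of a tree is the sum of its edge lengths. The elements of $X$ are called terminals. For a graph $G$, $V(G)$ and $E(G)$ are its node-set and edge-set, $G=\langle V(G),E(G)\rangle$, and $N(G,s)$ is the set of neighbours of a node $s$ in $G$. Viable forest: a forest $F$ with node-set $A\cup S$, where $A\subseteq X$ and $S\subseteq\mathbb{R}^2$ is a set of points (Steiner points, distinct from the terminals and internal nodes of $F$) with $|S|\le k$, is called viable if and only if the set of leaves of $F$ is exactly $A$ and $|N(F,\mathbf{s})|\le 6$ for every $\mathbf{s}\in S$. Minimum $F$-fixed spanning tree: a tree $T_F$ of shortest total length among the trees with node-set $X\cup S$ satisfying $N(T_F,\mathbf{s})=N(F,\mathbf{s})$ for every $\mathbf{s}\in S$. $P_G(\mathbf{x},\mathbf{y})$ denotes a path in a graph $G$ with endpoints $\mathbf{x},\mathbf{y}$, and $\ell_T(\mathbf{x},\mathbf{y})$ denotes the longest edge on $P_T(\mathbf{x},\mathbf{y})$, where ties between edges of equal length are broken consistently by fixing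 an order on $E(T)$ and choosing the earlier edge. PP1: calculate $\ell_T(\mathbf{x},\mathbf{y})$ for every pair of nodes $\mathbf{x},\mathbf{y}\in V(T)$. PP2: calculate a TRUE/FALSE table $H$ such that $H_{e,\mathbf{y},\mathbf{z}}=\mathrm{TRUE}$ if and only if the edge $e$ belongs to $E(P_T(\mathbf{y},\mathbf{z}))$. The stated running time is that of Algorithm $F$-MST after this preprocessing. Algorithm $F$-MST. Input: the set $X$, the minimum spanning tree $T$ on $X$, and a viable forest $F$ with $t$ connected components $F^1,\dots,F^t$; put $A^i=V(F^i)\cap X$. Output: $T_F$. Let $D^0=\emptyset$ and $T^0=T$. Step 1. For $i=1$ to $t$ do the following. Step 1a. For every distinct pair $\mathbf{x},\mathbf{y}\in A^i$: 1a(i). Let $J$ be the graph with node-set $V(J)=\{\{\mathbf{x}\},\{\mathbf{y}\}\}$ if $i=1$, and $V(J)=\{\{\mathbf{x}\},\{\mathbf{y}\},A^1,\dots,A^{i-1}\}$ if $i>1$, and with edge-set $E(J)=\{(U,U'):\ \exists\,\mathbf{w}\in U \text{ and } \exists\,\mathbf{w}'\in U' \text{ such that } H_{e',\mathbf{w},\mathbf{w}'}=\mathrm{FALSE}\ \text{for all } e'\in D^{i-1}\}$. 1a(ii). For every $e=(U,U')\in E(J)$ let $\sigma_1^J(e)=\mathbf{w}$ and $\sigma_2^J(e)=\mathbf{w}'$, where $\mathbf{w},\mathbf{w}'$ are the points from step 1a(i). 1a(iii). Perform a search through $J$ to find the path $P^i=P_J(\{\mathbf{x}\},\{\mathbf{y}\})$.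 Let $\ell^{\,i}(\mathbf{x},\mathbf{y})$ be the edge of maximum length from $\{\ell_T(\sigma_1^J(e),\sigma_2^J(e)): e\in E(P^i)\}$. After all pairs have been treated, let $L^i=\{\ell^{\,i}(\mathbf{x},\mathbf{y}):\mathbf{x},\mathbf{y}\in A^i\}$ (over distinct pairs), $D^i=D^{i-1}\cup L^i$, $G^i=T^{i-1}\cup F^i$, and $T^i=\langle V(G^i),\,E(G^i)\setminus D^i\rangle$. This ends the iteration for $i$. Finally, let $T_F=T^t$.
   Formalization: Every component of F is assumed to contain a Steiner point (a component that is a single edge between two terminals makes the claim false), and the search through J is taken to be breadth-first, since J may have cycles and an arbitrary path can give a wrong edge. *)

(* Defs.v *)
From mathcomp Require Import all_boot all_order all_algebra finmap reals.

Set Implicit Arguments.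
Unset Strict Implicit.
Unset Printing Implicit Defensive.

Import Order.TTheory GRing.Theory Num.Theory.

Local Open Scope fset_scope.
Local Open Scope nat_scope.

Section Graphs.
Variable P : choiceType.

Definition edge := {fset P}.

(* A raw graph <V, E>; it is a simple undirected graph when [simple_graph]
   holds. *)
Definition graph := ({fset P} * {fset edge})%type.
Definition nodes (G : graph) : {fset P} := G.1.
Definition edges (G : graph) : {fset edge} := G.2.

Definition adj (G : graph) : rel P := fun u v => [fset u; v] \in edges G.

Definition simple_graph (G : graph) : Prop :=
  forall e, e \in edges G ->
    exists u v, [/\ u != v, e = [fset u; v], u \in nodes G & v \in nodes G].

Definition nbhd (G : graph) (s : P) : {fset P} := [fset v in nodes G | adj G s v].
Definition degree (G : graph) (s : P) : nat := #|` nbhd G s|.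
Definition leaves (G : graph) : {fset P} := [fset v in nodes G | degree G v == 1].

Definition joined (G : graph) (x y : P) : Prop :=
  [/\ x \in nodes G, y \in nodes G & exists2 p, path (adj G) x p & last x p = y].

Definition is_forest (G : graph) : Prop :=
  simple_graph G /\ forall c : seq P, ucycle (adj G) c -> size c <= 2.

Definition is_tree (G : graph) : Prop :=
  [/\ is_forest G, nodes G != fset0
    & forall x y, x \in nodes G -> y \in nodes G -> joined G x y].

Definition is_component (F C : graph) : Prop :=
  exists2 x, x \in nodes F &
    (forall y, y \in nodes C <-> joined F x y)
    /\ edges C = [fset e in edges F | e `<=` nodes C].

(* [x :: p] is the node sequence of the path P_G(x, y). *)
Definition is_path (G : graph) (x y : P) (p : seq P) : Prop :=
  [/\ x \in nodes G, path (adj G) x p, uniq (x :: p) & last x p = y].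
Definition path_edges (x : P) (p : seq P) : seq edge :=
  pairmap (fun u v => [fset u; v]) x p.

(* Machine representation of a graph: its nodes and its edges listed in some
   arbitrary order. *)
Definition listing := (seq P * seq edge)%type.
Definition graph_of (L : listing) : graph :=
  ([fset v in L.1], [fset e in L.2]).
Definition lists_components (F : graph) (Fs : seq listing) : Prop :=
  [/\ forall L, L \in Fs -> uniq L.1 /\ uniq L.2,
      uniq [seq graph_of L | L <- Fs]
    & forall C, C \in [seq graph_of L | L <- Fs] <-> is_component F C].

Definition steiner (X : {fset P}) (F : graph) : {fset P} := nodes F `\` X.

Definition viable (X : {fset P}) (k : nat) (F : graph) : Prop :=
  [/\ is_forest F,
      #|` steiner X F| <= k,
      forall s, s \in steiner X F -> 1 < degree F s,
      leaves F = nodes F `&` X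
    & forall s, s \in steiner X F -> degree F s <= 6].

(* Excludes the components that consist of a single edge joining two terminals;
   such an edge is not constrained by the neighbourhoods of Steiner points. *)
Definition steiner_in_components (X : {fset P}) (F : graph) : Prop :=
  forall C, is_component F C -> exists2 s, s \in steiner X F & s \in nodes C.

Definition PP2 (T : graph) (H : edge -> P -> P -> bool) : Prop :=
  forall e y z p, e \in edges T -> is_path T y z p ->
    H e y z = (e \in path_edges y p).

End Graphs.

Section Lengths.
Variable R : realType.
Local Open Scope ring_scope.

Definition is_norm (nrm : 'rV[R]_2 -> R) : Prop :=
  [/\ forall u v, nrm (u + v) <= nrm u + nrm v,
      forall (a : R) u, nrm (a *: u) = `|a| * nrm u
    & forall u, nrm u = 0 -> u = 0].

Variable nrm : 'rV[R]_2 -> R.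

(* Junk value 0 on sets that are not pairs. *)
Definition elen (e : edge 'rV[R]_2) : R :=
  if (e : seq _) is [:: u; v] then nrm (u - v) else 0.

Definition total_length (G : graph 'rV[R]_2) : R := \sum_(e <- edges G) elen e.

Definition is_mst (X : {fset 'rV[R]_2}) (T : graph 'rV[R]_2) : Prop :=
  [/\ is_tree T, nodes T = X
    & forall G, is_tree G -> nodes G = X -> total_length T <= total_length G].

Definition F_fixed (X : {fset 'rV[R]_2}) (F G : graph 'rV[R]_2) : Prop :=
  [/\ is_tree G, nodes G = X `|` steiner X F
    & forall s, s \in steiner X F -> nbhd G s = nbhd F s].

Definition min_F_fixed (X : {fset 'rV[R]_2}) (F G : graph 'rV[R]_2) : Prop :=
  F_fixed X F G /\ forall G', F_fixed X F G' -> total_length G <= total_length G'.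

(* [o] lists E(T) in the fixed order: [e] is preferred to [f] when it is longer,
   or when it is equally long and earlier in [o]. *)
Definition longer (o : seq (edge 'rV[R]_2)) (e f : edge 'rV[R]_2) : bool :=
  (elen f < elen e) || (elen e == elen f) && (index e o < index f o)%N.

Definition is_longest o (s : seq (edge 'rV[R]_2)) (e : edge 'rV[R]_2) : Prop :=
  e \in s /\ forall f, f \in s -> f != e -> longer o e f.

Definition PP1 (T : graph 'rV[R]_2) o
    (ell : 'rV[R]_2 -> 'rV[R]_2 -> edge 'rV[R]_2) : Prop :=
  forall x y p, x != y -> is_path T x y p ->
    is_longest o (path_edges x p) (ell x y).

End Lengths.

(* Cost model. A computation returns its number of elementary steps together
   with its result. There is one way to produce a value, [op], and it costs one
   step; inside [op] only constant-time operations of a random access machine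
   occur: pairing, consing, comparing two numbers, points or edges, deciding
   whether a given point is a terminal, reading one entry of a precomputed table,
   inserting or deleting one node or edge of the current tree. Every loop goes
   through the combinators below, which charge one further step per iteration. *)
Definition timed (A : Type) := (nat * A)%type.
Definition op A (a : A) : timed A := (1, a).
Definition bind A B (m : timed A) (f : A -> timed B) : timed B :=
  let r := f m.2 in (m.1 + r.1, r.2).
Definition tick A (m : timed A) : timed A := (m.1.+1, m.2).

Notation "'let*' x ':=' m 'in' f" := (bind m (fun x => f))
  (at level 200, x name, m at level 100, f at level 200, right associativity).

Section Loops.
Variables A B : Type.

Fixpoint for_each (s : seq A) (f : A -> B -> timed B) (b : B) : timed B :=
  if s is a :: s' then tick (let* b' := f a b in for_each s' f b') else op b.

Fixpoint first_some (s : seq A) (f : A -> timed (option B)) : timed (option B) :=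
  if s is a :: s' then
    tick (let* r := f a in if r is Some b then op (Some b) else first_some s' f)
  else op None.

Fixpoint holds_for_all (s : seq A) (f : A -> timed bool) : timed bool :=
  if s is a :: s' then
    tick (let* r := f a in if r then holds_for_all s' f else op false)
  else op true.

End Loops.

Section Algorithm.
Variable P : choiceType.
Variables (X : {fset P}) (T : graph P).
(* [ell] and [H] are the precomputed tables; [lgr e f] means that [e] is preferred
   to [f] as a longest edge. *)
Variable ell : P -> P -> edge P.
Variable H : edge P -> P -> P -> bool.
Variable lgr : rel (edge P).

(* Nodes of J carry a number, by which they are compared:
   {x} is number 0, {y} is number 1 and A^j is number j + 1. *)
Definition Jnode := (nat * seq P)%type.

(* An edge of J, given by the numbers of its two ends U and U', with the points
   sigma_1 in U and sigma_2 in U'. *)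
Record Jedge := MkJedge { end1 : nat; end2 : nat; sigma1 : P; sigma2 : P }.

Definition find_witness (D : seq (edge P)) (U U' : seq P) : timed (option (P * P)) :=
  first_some U (fun w =>
  first_some U' (fun w' =>
    let* b := holds_for_all D (fun e => op (~~ H e w w')) in
    op (if b then Some (w, w') else None))).

(* Each edge {U, U'} of J is recorded once, from the smaller number to the larger. *)
Definition build_J (VJ : seq Jnode) (D : seq (edge P)) : timed (seq Jedge) :=
  for_each VJ (fun U es =>
  for_each VJ (fun U' es =>
    if U.1 < U'.1 then
      let* r := find_witness D U.2 U'.2 in
      op (if r is Some (w, w') then MkJedge U.1 U'.1 w w' :: es else es)
    else op es) es) [::].

Definition across (u : nat) (e : Jedge) : option nat :=
  if end1 e == u then Some (end2 e)
  else if end2 e == u then Some (end1 e) else None.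

(* Breadth-first search, so that the path found has as few edges as possible.
   This matters: J contains a clique for every component of T - D^{i-1}, and a path
   making a detour through a third node of a clique may produce an edge that is
   not on the path joining x and y in T^{i-1}. A reached node comes with the edges of the path by
   which it was reached, last edge first; [st.1] is the list of the nodes
   reached in the latest round, [st.2] the list of all the nodes reached. *)
Definition reached := seq (nat * seq Jedge).

Definition bfs_round (EJ : seq Jedge) (st : reached * reached)
    : timed (reached * reached) :=
  for_each st.1 (fun up st' =>
  for_each EJ (fun e st' =>
    if across up.1 e is Some v then
      let* r := first_some st'.2 (fun vq =>
                  op (if vq.1 == v then Some tt else None)) in
      op (if r is Some _ then st'
          else ((v, e :: up.2) :: st'.1, (v, e :: up.2) :: st'.2))
    else op st') st') ([::], st.2).

Definition search (VJ : seq Jnode) (EJ : seq Jedge) : timed (option (seq Jedge)) :=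
  let* st := for_each VJ (fun _ st => bfs_round EJ st)
               ([:: (0, [::])], [:: (0, [::])]) in
  first_some st.2 (fun vq => op (if vq.1 == 1 then Some vq.2 else None)).

Definition longest_on (p : seq Jedge) : timed (option (edge P)) :=
  for_each p (fun e best =>
    let* f := op (ell (sigma1 e) (sigma2 e)) in
    op (if best is Some g then (if lgr f g then Some f else Some g)
        else Some f)) None.

(* [As] lists the numbered A^1, ..., A^{i-1}. *)
Definition treat_pair (As : seq Jnode) (D : seq (edge P)) (x y : P)
    : timed (option (edge P)) :=
  let* VJ := op ((0, [:: x]) :: (1, [:: y]) :: As) in
  let* EJ := build_J VJ D in
  let* p := search VJ EJ in
  if p is Some p then longest_on p else op None.

Definition treat_pairs (As : seq Jnode) (D : seq (edge P)) (A : seq P)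
    : timed (seq (edge P)) :=
  for_each A (fun x L =>
  for_each A (fun y L =>
    if x != y then
      let* r := treat_pair As D x y in
      op (if r is Some e then e :: L else L)
    else op L) L) [::].

Definition terminals_of (vs : seq P) : timed (seq P) :=
  for_each vs (fun v A => op (if v \in X then v :: A else A)) [::].

Definition add_node (v : P) (G : graph P) : graph P := (v |` nodes G, edges G).
Definition add_edge (e : edge P) (G : graph P) : graph P := (nodes G, e |` edges G).
Definition del_edge (e : edge P) (G : graph P) : graph P := (nodes G, edges G `\ e).

(* The current tree is updated in place: T^{i-1} is never used again once T^i has
   been formed. *)
Definition update_tree (Fi : listing P) (D : seq (edge P)) (G : graph P)
    : timed (graph P) :=
  let* G := for_each Fi.1 (fun v G => op (add_node v G)) G in
  let* G := for_each Fi.2 (fun e G => op (add_edge e G)) G in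
  for_each D (fun e G => op (del_edge e G)) G.

(* State on entering iteration i: the number i, the sets A^1, ..., A^{i-1}, the
   set D^{i-1} (as a list, possibly with repetitions) and T^{i-1}. *)
Record state := MkState
  { idx : nat; prevA : seq Jnode; delD : seq (edge P); curT : graph P }.

Definition iteration (Fi : listing P) (st : state) : timed state :=
  let* A := terminals_of Fi.1 in
  let* L := treat_pairs (prevA st) (delD st) A in
  let* D := for_each L (fun e D => op (e :: D)) (delD st) in
  let* G := update_tree Fi D (curT st) in
  op (MkState (idx st).+1 (((idx st).+1, A) :: prevA st) D G).

Definition F_MST (Fs : seq (listing P)) : timed (graph P) :=
  let* st := for_each Fs iteration (MkState 1 [::] [::] T) in
  op (curT st).

End Algorithm.

(* Main.v *)
Require Import Defs.
From mathcomp Require Import all_boot all_order all_algebra finmap reals.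
From mathcomp Require Import zify.
From mathcomp Require boolp.
From Stdlib Require Import Classical.
From Stdlib Require List.

(** Why the algorithm is correct.  Every edge of a viable forest [F] has a Steiner
    end (terminals are leaves, so an edge joining two of them would be a whole
    component, without the Steiner point that each one contains), so an
    [F]-fixed spanning tree is [F] together with edges between terminals, and
    the task is to choose the latter as short as possible.

    The algorithm adds the components of [F] one at a time.  When a component
    with terminals [A] is joined to the current tree, each pair of points of [A]
    closes a cycle, and the longest remaining edge of [T] on the path between
    them is removed.  Two properties survive each iteration.
    - The result is again a spanning tree ([joined_spanning]).  A longest edge
      was removed between any two points of [A], so these are apart; and a
      removed edge stays linked to [A], because whatever else is removed from
      its path is shorter, which allows an induction on the order of the edges.
    - The remaining edges of [T] are light ([joined_light]): none is longer than
      a chord between terminals that closes a cycle through it.  If the cycle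
      has come to use the new component, the remaining edge lies on the path
      between two points of [A], hence is shorter than the edge removed there,
      and that edge lay on the old cycle of the same chord.
    For [T] itself lightness is the cycle property of minimum spanning trees
    ([mst_light]), and by exchange a light tree is minimal ([light_minimal]).

    The algorithm does not walk in the current tree but in the graph [J].
    Breadth-first search returns a path of [J] without chords ([search_run]).
    Its stretches therefore run in different components of the forest of
    remaining edges, so an edge used by one of them is used by no other one and
    really separates [x] from [y] in the current tree; the longest table entry
    along the path is then the edge to be removed ([treat_pair_run]).

    Paths are replaced by separation throughout: an edge [e] of a tree [E] lies
    on the path from [x] to [y] when [x] and [y] are not connected in [E `\ e].

    The cost is polynomial: [F] has at most [k] components and [6 * k] edges, and
    a fixed number of nested loops over lists of size O([k ^ 3]) gives
    O([k ^ 45]), crude but below a constant times [k ^ (2 * k + 3)]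
    ([polynomial_cost]). *)

Set Implicit Arguments.
Unset Strict Implicit.
Unset Printing Implicit Defensive.

Import Order.TTheory GRing.Theory Num.Theory.

Local Open Scope fset_scope.
Local Open Scope nat_scope.

(** * Connectivity and separating edges *)

Section Connectivity.
Variable P : choiceType.
Implicit Types (E : {fset edge P}) (V : {fset P}) (e g h : edge P).

Inductive conn E : P -> P -> Prop :=
| conn_refl x : conn E x x
| conn_step x y z : [fset x; y] \in E -> conn E y z -> conn E x z.

Lemma conn1 E x y : [fset x; y] \in E -> conn E x y.
Proof. by move=> xy; apply: conn_step xy _; apply: conn_refl. Qed.

Lemma conn_trans E y x z : conn E x y -> conn E y z -> conn E x z.
Proof.
by move=> xy; elim: xy z => // {}x {}y y' xy _ IH z /IH; apply: conn_step.
Qed.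

Lemma conn_sym E x y : conn E x y -> conn E y x.
Proof.
elim=> [z|{}x {}y z xy _ IH]; first exact: conn_refl.
by apply: conn_trans IH _; apply: conn1; rewrite fsetUC.
Qed.

Lemma conn_bind E E' x y :
  (forall u v, [fset u; v] \in E -> conn E' u v) -> conn E x y -> conn E' x y.
Proof.
move=> EE'; elim=> [z|{}x {}y z xy _ IH]; first exact: conn_refl.
exact: conn_trans (EE' _ _ xy) IH.
Qed.

Lemma conn_sub E E' x y : {subset E <= E'} -> conn E x y -> conn E' x y.
Proof. by move=> EE'; apply: conn_bind => u v /EE'; apply: conn1. Qed.

Lemma conn_closed E (C : P -> Prop) x y :
  (forall u v, [fset u; v] \in E -> C u -> C v) -> conn E x y -> C x -> C y.
Proof. by move=> cl; elim=> // {}x {}y z xy _ IH /(cl _ _ xy). Qed.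

Lemma fset2_eq (x y u v : P) : [fset x; y] = [fset u; v] ->
  x = u /\ y = v \/ x = v /\ y = u.
Proof.
move=> /fsetP eq2; move: (eq2 x) (eq2 y) (eq2 u) (eq2 v).
rewrite !inE !eqxx /= !orbT => /esym/orP xuv /esym/orP yuv /orP uxy /orP vxy.
case: xuv yuv => /eqP ? [] /eqP ?; subst; auto.
  by case: vxy => /eqP ?; subst; auto.
by case: uxy => /eqP ?; subst; auto.
Qed.

(** A walk using the edge [u v] can be cut at its first and at its last passage
    through that edge. *)
Lemma conn_bridge E u v x y :
  conn E x y ->
  let E' := E `\ [fset u; v] in
  [\/ conn E' x y, conn E' x u /\ conn E' v y | conn E' x v /\ conn E' u y].
Proof.
move=> xy E'; elim: xy => [z|{}x {}y z xy _ IH]; first exact: Or31 (conn_refl _ _).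
have [uv|neq] := eqVneq [fset x; y] [fset u; v]; last first.
  have xy' : conn E' x y by apply: conn1; rewrite !inE neq.
  case: IH => [?|[??]|[??]]; [apply: Or31|apply: Or32|apply: Or33] => //;
    try split => //; exact: conn_trans xy' _.
case: (fset2_eq uv) => [][? ?]; subst x y;
  case: IH => [uz|[uu vz]|[uv' uz]].
- by apply: Or32; split; first exact: conn_refl.
- by apply: Or32; split; first exact: conn_refl.
- exact: Or31.
- by apply: Or33; split; first exact: conn_refl.
- exact: Or31.
- by apply: Or33; split; first exact: conn_refl.
Qed.

(** In a forest this says that [e] lies on the path joining [x] and [y].
    Separation instead of paths makes the arguments on trees a matter of
    transitivity of [conn]. *)
Definition sep E e x y := ~ conn (E `\ e) x y.

(** Asking each edge for two ends that it separates excludes sets of other sizes,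
    and loops, since an edge never separates a point from itself. *)
Definition acyclic E :=
  forall e, e \in E -> exists u v, e = [fset u; v] /\ sep E e u v.

Definition pairs_of V E :=
  forall e, e \in E -> exists u v, [/\ e = [fset u; v], u \in V & v \in V].

Definition spanning V E :=
  [/\ acyclic E, pairs_of V E & forall u v, u \in V -> v \in V -> conn E u v].

Lemma pairs_ofP V E u v : pairs_of V E -> [fset u; v] \in E -> u \in V /\ v \in V.
Proof.
move=> VE /VE [a [b [uv aV bV]]].
have in_V z : z \in [fset u; v] -> z \in V.
  by rewrite uv !inE => /orP[]/eqP->.
by split; apply: in_V; rewrite !inE eqxx ?orbT.
Qed.

Lemma conn_in V E x y : pairs_of V E -> conn E x y -> x \in V -> y \in V.
Proof.
by move=> VE xy xV; apply: (conn_closed (C := fun z => z \in V)) xy xV => u v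
  /(pairs_ofP VE)[].
Qed.

Lemma sep_mem E e x y : conn E x y -> sep E e x y -> e \in E.
Proof.
move=> xy sxy; apply/negPn/negP => eE; apply: sxy.
apply: conn_sub xy => h hE; rewrite !inE hE andbT.
by apply: contraNneq eE => <-.
Qed.

Lemma sep_sub E E' e x y : {subset E <= E'} -> sep E' e x y -> sep E e x y.
Proof.
move=> EE' s xy; apply: s; apply: conn_sub xy => h.
by rewrite !inE => /andP[-> /EE'].
Qed.

Lemma acyclic_sub E E' : {subset E <= E'} -> acyclic E' -> acyclic E.
Proof.
move=> EE' aE e /EE'/aE[u [v [-> s]]]; exists u, v; split=> //.
exact: sep_sub s.
Qed.



(** A forest joins two points by one path only, so a path of a subforest is
    still the path of the whole forest. *)
Lemma sep_ext E E1 e x y : acyclic E -> {subset E1 <= E} ->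
  conn E1 x y -> sep E1 e x y -> sep E e x y.
Proof.
move=> aE E1E xy sxy xyE; have [u [v [eE]]] := aE _ (E1E _ (sep_mem xy sxy)).
apply; rewrite {}eE in sxy xyE *.
have sub : {subset E1 `\ [fset u; v] <= E `\ [fset u; v]}.
  by move=> h; rewrite !inE => /andP[-> /E1E].
have C := conn_sub sub.
case: (conn_bridge u v xy) => [//|[/C xu /C vy]|[/C xv /C uy]].
  exact: conn_trans (conn_sym xu) (conn_trans xyE (conn_sym vy)).
exact: conn_trans uy (conn_trans (conn_sym xyE) xv).
Qed.

(** The set [K] is the path from [x] to [y], found by shrinking [E]: an edge that
    does not separate the points can be dropped, and this creates no new
    separator. *)
Lemma conn_separators E x y : acyclic E -> conn E x y ->
  exists2 K : {fset edge P}, conn K x y & forall e, e \in K -> sep E e x y.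
Proof.
have [n] := ubnP #|` E|; elim: n => // n IH in E * => /ltnSE leEn aE xy.
have [all_sep|] := classic (forall e, e \in E -> sep E e x y).
  by exists E.
case/not_all_ex_not=> e nsep; case: (imply_to_and _ _ nsep) => eE /NNPP xye.
have sub : {subset E `\ e <= E} by move=> h; rewrite !inE => /andP[].
have [|K xyK KP] := IH (E `\ e) _ (acyclic_sub sub aE) xye.
  by rewrite (leq_trans _ leEn)// [X in _ < X](cardfsD1 e) eE.
by exists K => // h /KP; apply: sep_ext xye.
Qed.

(** The ends of the removed edge [e] remain connected through the chord, on
    whose cycle [e] lies. *)
Lemma spanning_swap V E e x y : spanning V E -> x \in V -> y \in V ->
  sep E e x y -> spanning V ([fset x; y] |` E `\ e).
Proof.
move=> [aE VE cE] xV yV sxy; set f := [fset x; y].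
have eE := sep_mem (cE _ _ xV yV) sxy.
have [fE|fE] := boolP (f \in E `\ e).
  by case: sxy; apply: conn1.
have subE : {subset E `\ e <= E} by move=> h; rewrite !inE => /andP[].
have subf : {subset E `\ e <= f |` E `\ e}.
  by move=> h; rewrite in_fset1U orbC => ->.
have fsubf : (f |` E `\ e) `\ f = E `\ e.
  by rewrite fsetU1K.
have [u [v [euv suv]]] := aE _ eE.
have [uV vV] : u \in V /\ v \in V by apply: pairs_ofP VE _; rewrite -euv.
have uvf : conn (f |` E `\ e) u v.
  have := cE _ _ xV yV => /(conn_bridge u v); rewrite -euv /=.
  have xyf : conn (f |` E `\ e) x y by apply: conn1; rewrite in_fset1U eqxx.
  have C := conn_sub subf.
  case=> [//|[/C xu /C vy]|[/C xv /C uy]].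
    exact: conn_trans (conn_sym xu) (conn_trans xyf (conn_sym vy)).
  exact: conn_trans uy (conn_trans (conn_sym xyf) xv).
split.
- move=> h; rewrite in_fset1U => /orP[/eqP->|hE].
    by exists x, y; split=> //; rewrite /sep fsubf.
  have [a [b [hab sab]]] := aE _ (subE _ hE).
  exists a, b; split=> // abf.
  (* were the chord to join the ends of h in E - e - h, these ends, which h
     connects, would lie on both sides of e *)
  have sub' : {subset E `\ e `\ h <= E `\ h}.
    by move=> g; rewrite !inE => /and3P[-> _ ->].
  have := conn_bridge x y abf; rewrite -/f.
  have nfh : f != h by apply: contraNneq fE => ->.
  have -> : (f |` E `\ e) `\ h `\ f = E `\ e `\ h.
    apply/fsetP => g; rewrite !inE.
    have [->|//] := eqVneq g f.
    by move: fE; rewrite !inE /= => /negPf->; rewrite andbF.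
  have sabe : ~ conn (E `\ e `\ h) a b by move=> /(conn_sub sub').
  have C : forall c d, conn (E `\ e `\ h) c d -> conn (E `\ e) c d.
    by move=> c d; apply: conn_sub => g; rewrite inE => /andP[].
  have ab : conn (E `\ e) a b by apply: conn1; rewrite -hab.
  case=> [//|[/C ax /C yb]|[/C ay /C xb]]; apply: sxy.
    exact: conn_trans (conn_sym ax) (conn_trans ab (conn_sym yb)).
  exact: conn_trans xb (conn_trans (conn_sym ab) ay).
- move=> h; rewrite in_fset1U => /orP[/eqP->|/subE/VE//].
  by exists x, y.
- move=> a b aV bV; apply: conn_bind (cE _ _ aV bV) => c d cd.
  have [cde|cde] := eqVneq [fset c; d] e; last first.
    by apply: conn1; apply: subf; rewrite !inE cde.
  by case: (fset2_eq (etrans cde euv)) => [][-> ->] //; apply: conn_sym.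
Qed.

End Connectivity.

(** * Paths, cycles and trees in terms of connectivity *)

Section Paths.
Variable P : choiceType.
Implicit Types (G : graph P) (E : {fset edge P}) (V : {fset P}) (x y : P).

Lemma path_conn G e x p : path (adj G) x p -> e \notin path_edges x p ->
  conn (edges G `\ e) x (last x p).
Proof.
elim: p x => [|y p IH] x /=; first by move=> *; apply: conn_refl.
rewrite inE negb_or => /andP[xy yp] /andP[exy /(IH _ yp)].
by apply: conn_step; rewrite !inE eq_sym exy.
Qed.

Lemma conn_del E e x y : conn (E `\ e) x y -> conn E x y.
Proof. by apply: conn_sub => h; rewrite !inE => /andP[]. Qed.

Lemma path_conn_all G x p : path (adj G) x p -> conn (edges G) x (last x p).
Proof.
elim: p x => [|y p IH] x /=; first by move=> *; apply: conn_refl.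
by move=> /andP[xy /IH]; apply: conn_step.
Qed.

Lemma conn_path G x y : conn (edges G) x y ->
  exists p, [/\ path (adj G) x p, uniq (x :: p) & last x p = y].
Proof.
move=> xy; have [p pth <-] : exists2 p, path (adj G) x p & last x p = y.
  elim: xy => [z|{}x {}y z xy _ [p yp <-]]; first by exists [::].
  by exists (y :: p); rewrite //= /adj xy.
by case: (shortenP pth) => q; exists q.
Qed.

Lemma path_edges_sub x p e z : e \in path_edges x p -> z \in e -> z \in x :: p.
Proof.
elim: p x => // y p IH x; rewrite /= inE => /orP[/eqP->|/IH yp /yp].
  by rewrite !inE => /orP[]->; rewrite ?orbT.
by rewrite !inE => ->; rewrite orbT.
Qed.

(** The edges of a simple path of a forest separate its ends: the rest of the
    path joins each end to an end of the edge. *)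
Lemma path_sep G x p e : acyclic (edges G) -> path (adj G) x p ->
  uniq (x :: p) -> e \in path_edges x p -> sep (edges G) e x (last x p).
Proof.
move=> aG; elim: p x => // y p IH x /= /andP[xy yp] /andP[xyp uyp].
rewrite inE => /orP[/eqP->|eyp].
  have yz : conn (edges G `\ [fset x; y]) y (last y p).
    apply: path_conn => //; apply: contraNN xyp => /path_edges_sub; apply.
    by rewrite !inE eqxx.
  have [u [v [uv suv]]] := aG _ xy => xz; have xy' := conn_trans xz (conn_sym yz).
  by case: (fset2_eq uv) => [][xE yE]; subst u v; apply: suv => //; apply: conn_sym.
have ne : [fset x; y] != e.
  apply: contraNneq xyp => exy; apply: path_edges_sub eyp _.
  by rewrite -exy !inE eqxx.
have xye : conn (edges G `\ e) x y by apply: conn1; rewrite !inE ne.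
by move/(conn_trans (conn_sym xye)); apply: IH.
Qed.

Lemma is_forestP G : simple_graph G -> is_forest G <-> acyclic (edges G).
Proof.
move=> sG; split=> [[_ cyc] e eE|aG].
  have [u [v [uv eE' uV vV]]] := sG _ eE; exists u, v; split=> // uve.
  have [p [pth upp lp]] := conn_path (G := (nodes G, edges G `\ e)) uve.
  have := cyc (u :: p); rewrite /ucycle upp andbT /=.
  have -> : path (adj G) u (rcons p u).
    rewrite rcons_path lp /adj fsetUC -eE' eE andbT.
    by apply: sub_path pth => a b; rewrite /adj !inE => /andP[].
  move=> /(_ isT); case: p pth lp {upp} => [|a [|b p]] //=.
    by move=> _ uvE; rewrite uvE eqxx in uv.
  by rewrite /adj !inE eE' => + av; rewrite av eqxx.
split=> // [[|x [|y [|z p]]]] //= /andP[/=].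
rewrite rcons_path => /and4P[xy yz zp lx] /and4P[xyzp yzp uz up].
exfalso; have yE : [fset x; y] \in path_edges x [:: y, z & p].
  by rewrite /= inE eqxx.
apply: (path_sep aG _ _ yE); rewrite /= ?xy ?yz ?zp //.
  by apply/and4P; split.
apply: conn_sym; apply: conn1; rewrite in_fsetD1.
apply/andP; split; last exact: lx.
apply/eqP => /fset2_eq[][l1 l2].
  by move: xyzp; rewrite l2 inE eqxx.
by move: yzp; rewrite -l1 mem_last.
Qed.

Lemma is_treeP G : is_tree G <->
  [/\ spanning (nodes G) (edges G), nodes G != fset0 & simple_graph G].
Proof.
split=> [[fG G0 cG]|[[aG pG cG] G0 sG]].
  have sG := fG.1; split=> //; split.
  - by apply/is_forestP.
  - by move=> e /sG[u [v [_ eE uV vV]]]; exists u, v.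
  - by move=> u v uV vV; have [_ _ [p /path_conn_all + <-]] := cG _ _ uV vV.
split=> // [|u v uV vV]; first exact/is_forestP.
split=> //; have [p [pth _ lp]] := conn_path (cG _ _ uV vV).
by exists p.
Qed.

Lemma spanning_simple V E : spanning V E -> simple_graph (V, E).
Proof.
move=> [aE VE _] e eE; have [u [v [eE' uV vV]]] := VE _ eE.
exists u, v; split=> //; have [a [b [eab sab]]] := aE _ eE.
apply/eqP => uv; apply: sab.
suff -> : a = b by apply: conn_refl.
by move: eab; rewrite eE' uv => /fset2_eq[][<- <-].
Qed.

(** Simple paths could be prolonged for ever: of two neighbours of the first
    point, one is not the second point, and it cannot lie further on the path
    without closing a cycle. *)
Lemma acyclic_leaf E V : acyclic E -> V != fset0 ->
  ~ (forall x, x \in V -> exists y z, [/\ y != z, [fset x; y] \in E,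
       [fset x; z] \in E, y \in V & z \in V]).
Proof.
move=> aE /fset0Pn[x0 x0V] two; pose G : graph P := (V, E).
have long n : exists x p, [/\ size p = n, path (adj G) x p, uniq (x :: p)
    & {subset x :: p <= V}].
  elim: n => [|n [x [p [<- pth up pV]]]].
    by exists x0, [::]; split=> // z; rewrite inE => /eqP->.
  have xV : x \in V by apply: pV; rewrite inE eqxx.
  have [z [zp xz zV]] : exists z, [/\ z != head z p \/ p = [::], [fset x; z] \in E & z \in V].
    have [y [z [yz xy xz yV zV]]] := two _ xV.
    case: p {up pth pV} => [|a p]; first by exists y; split=> //; right.
    have [ya|ya] := eqVneq y a; last by exists y; split=> //; left.
    by exists z; split=> //; left; rewrite /= -ya eq_sym.
  exists z, (x :: p); split=> //=; first by rewrite /adj fsetUC xz.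
    rewrite -[(x \notin p) && _]/(uniq (x :: p)) up andbT.
    apply/negP => zxp; have [u [v [euv suv]]] := aE _ xz.
    have nxz : ~ conn (E `\ [fset x; z]) x z.
      by case: (fset2_eq euv) suv => [][<- <-] suv // /conn_sym.
    move: zxp; rewrite inE => /orP[/eqP zx|zp'].
      by apply: nxz; rewrite zx; apply: conn_refl.
    case/path.splitP: zp' => p1 p2 in pth up zp.
    move: pth; rewrite cat_path => /andP[pth _]; apply: nxz.
    have := path_conn pth; rewrite last_rcons; apply.
    move: up; rewrite -cat_cons cat_uniq => /andP[up _].
    case: p1 up zp {pth} => [|a p1] /= up; first by rewrite eqxx; case.
    case=> [za|//]; rewrite inE negb_or; apply/andP; split.
      apply: contraNneq za => /fset2_eq[][].
        by move=> _ ->.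
      by move=> <- ->.
    apply: contraTN up => xzp.
    have := path_edges_sub (z := x) xzp; rewrite !inE eqxx => /(_ isT) ->.
    by [].
  by move=> w; rewrite inE => /orP[/eqP->//|/pV].
have [x [p [sp _ up pV]]] := long #|` V|.
have := uniq_leq_size up (s2 := V) pV.
by rewrite /= sp ltnn.
Qed.

End Paths.

(** * Longest separators and the preprocessed tables *)

Section Preprocessing.
Variable P : choiceType.
Implicit Types (T : graph P) (E B : {fset edge P}) (lgr : rel (edge P)).

(** The edge that has to leave the tree [E] when [x] and [y] get identified and
    only the edges in [B] may be removed.  The table entry [ell x y] is the case
    where [E] and [B] are both the minimum spanning tree. *)
Definition longest_sep lgr E B g x y :=
  [/\ g \in B, sep E g x y
    & forall h, h \in B -> sep E h x y -> h != g -> lgr g h].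

(** The local form of optimality: an edge of the tree [E] that may be removed
    is no longer than any chord between points of [X] whose cycle contains it. *)
Definition light (X : {fset P}) (le : edge P -> edge P -> Prop) E B :=
  forall x y e, x \in X -> y \in X -> e \in B -> sep E e x y -> le e [fset x; y].

Lemma tree_path T x y : is_tree T -> x \in nodes T -> y \in nodes T ->
  exists p, [/\ is_path T x y p
    & forall e, e \in edges T -> e \in path_edges x p <-> sep (edges T) e x y].
Proof.
move=> /is_treeP[[aT _ cT] _ _] xT yT.
have [p [pth up lp]] := conn_path (cT _ _ xT yT); exists p; split=> // e eT.
split=> [|s]; first by rewrite -lp; apply: path_sep.
by apply/negPn/negP => ep; apply: s; rewrite -lp; apply: path_conn.
Qed.

Lemma PP2_sep T H e x y : is_tree T -> PP2 T H -> e \in edges T ->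
  x \in nodes T -> y \in nodes T -> H e x y <-> sep (edges T) e x y.
Proof.
move=> tT HT eT xT yT; have [p [pth pE]] := tree_path tT xT yT.
by rewrite (HT _ _ _ _ eT pth); apply: pE.
Qed.

Lemma path_edges_in T x p : path (adj T) x p -> {subset path_edges x p <= edges T}.
Proof.
elim: p x => //= y p IH x /andP[xy /IH yp] e.
by rewrite inE => /orP[/eqP->|/yp].
Qed.

End Preprocessing.

Lemma PP1_sep (R : realType) (nrm : 'rV[R]_2 -> R) (T : graph 'rV[R]_2) o ell x y :
  is_tree T -> PP1 nrm T o ell -> x != y -> x \in nodes T -> y \in nodes T ->
  longest_sep (longer nrm o) (edges T) (edges T) (ell x y) x y.
Proof.
move=> tT ellT xy xT yT; have [p [pth pE]] := tree_path tT xT yT.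
have [gp gmax] := ellT _ _ _ xy pth.
have gT : ell x y \in edges T by case: pth => _ pth _ _; apply: path_edges_in gp.
split=> //; first exact/pE.
by move=> h hT /(pE _ hT); apply: gmax.
Qed.

(** * Joining a tree to a spanning tree *)

Section Contraction.
Variables (P : choiceType) (lgr : rel (edge P)).
Hypotheses (lgr_trans : transitive lgr) (lgr_irr : irreflexive lgr).
Variables (V N : {fset P}) (E B EF L : {fset edge P}).
Hypotheses (spE : spanning V E) (BE : {subset B <= E}).
Hypotheses (spEF : spanning N EF) (meet : V `&` N != fset0).
Hypothesis L_sep : forall g, g \in L ->
  exists a b, [/\ a \in V `&` N, b \in V `&` N & longest_sep lgr E B g a b].
Hypothesis sep_L : forall a b, a \in V `&` N -> b \in V `&` N -> a != b ->
  exists2 g, g \in L & longest_sep lgr E B g a b.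

Let LB : {subset L <= B}.
Proof. by move=> g /L_sep[a [b [_ _ []]]]. Qed.

Let rest_sub : {subset E `\` L <= E}.
Proof. by move=> e; rewrite inE => /andP[]. Qed.

Let meetV a : a \in V `&` N -> a \in V.
Proof. by rewrite inE => /andP[]. Qed.

Let meetN a : a \in V `&` N -> a \in N.
Proof. by rewrite inE => /andP[]. Qed.

(** The longest separator of [a] and [b] is gone. *)
Lemma meet_apart a b : a \in V `&` N -> b \in V `&` N ->
  conn (E `\` L) a b -> a = b.
Proof.
move=> aA bA ab; apply/eqP/negPn/negP => /(sep_L aA bA)[g gL [_ s _]].
apply: s; apply: conn_sub ab => h; rewrite !inE => /andP[hL ->].
by rewrite andbT; apply: contraNneq hL => ->.
Qed.

Let reached z := exists2 a, a \in V `&` N & conn (E `\` L) z a.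

Let reached_step z z' : [fset z; z'] \in E -> reached z ->
  ([fset z; z'] \in L -> reached z') -> reached z'.
Proof.
move=> zz' [a aA za] inL; have [|nL] := boolP ([fset z; z'] \in L) => //.
exists a => //; apply: conn_trans za; apply: conn1.
by rewrite inE fsetUC nL.
Qed.

(** A removed edge [g] is the longest one on the path between two points of the
    intersection, so whatever else is removed from that path is shorter, and
    the shorter edges do not cut [g] off, by induction. *)
Let reached_removed g z : g \in L -> z \in g -> reached z.
Proof.
have [n] := ubnP #|` [fset h in B | lgr g h]|.
elim: n => // n IH in g z * => /ltnSE len gL zg.
have [a [b [aA bA [gB sg gmax]]]] := L_sep gL.
have [aE _ cE] := spE; have ab := cE _ _ (meetV aA) (meetV bA).
have [K abK KP] := conn_separators aE ab.
have walk c d : reached c -> conn (K `\ g) c d -> reached d.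
  move=> rc cd; apply: (conn_closed (C := reached)) cd rc => u v.
  rewrite in_fsetD1 => /andP[uvg /KP suv] ru.
  apply: reached_step ru _; first exact: sep_mem suv.
  move=> uvL; have uvB := LB uvL; have gl : lgr g [fset u; v] by apply: gmax.
  apply: IH uvL _; last by rewrite !inE eqxx orbT.
  apply: leq_trans len; apply: fproper_ltn_card; rewrite fproperE.
  apply/andP; split.
    by apply/fsubsetP=> h; rewrite !inE => /andP[-> /(lgr_trans gl)].
  apply/fsubsetPn; exists [fset u; v]; rewrite !inE /= ?lgr_irr ?andbF//.
  by apply/andP.
have ra : reached a by exists a => //; apply: conn_refl.
have rb : reached b by exists b => //; apply: conn_refl.
have [u [v [guv _]]] := aE _ (BE gB).
have [ru rv] : reached u /\ reached v.
  case: (conn_bridge u v abK); rewrite -guv.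
  - by move=> abKg; case: sg; apply: conn_sub abKg => h;
      rewrite !in_fsetD1 => /andP[-> /KP/(sep_mem ab)].
  - by move=> [/(walk _ _ ra) ru /conn_sym/(walk _ _ rb) rv].
  - by move=> [/(walk _ _ ra) rv /conn_sym/(walk _ _ rb) ru].
by move: zg; rewrite guv !inE => /orP[]/eqP->.
Qed.

Lemma reach_meet z : z \in V -> exists2 a, a \in V `&` N & conn (E `\` L) z a.
Proof.
move=> zV; have [a aA] := fset0Pn _ meet.
have ra : reached a by exists a => //; apply: conn_refl.
have [_ _ cE] := spE; apply: (conn_closed (C := reached)) (cE _ _ (meetV aA) zV) ra.
move=> u v uv ru; apply: reached_step ru _ => // uvL.
by apply: reached_removed uvL _; rewrite !inE eqxx orbT.
Qed.

Definition joined_tree := (E `\` L) `|` EF.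

Let rest_V : pairs_of V (E `\` L).
Proof. by move=> e /rest_sub; case: spE => _ VE _ /VE. Qed.

Let aR : acyclic (E `\` L).
Proof. by case: spE => aE _ _; apply: acyclic_sub aE. Qed.

(* A walk that leaves one of the two forests through the intersection can only
   come back to it at a connected point of the intersection, that is where it
   left. *)
Let joined_acyclic : acyclic joined_tree.
Proof.
have [aF NF _] := spEF.
have sub1 e : {subset (E `\` L) `\ e <= E `\` L} by move=> h; rewrite in_fsetD1 => /andP[].
have sub2 e : {subset EF `\ e <= EF} by move=> h; rewrite in_fsetD1 => /andP[].
move=> e; rewrite inE => /orP[eR|eF].
  have [u [v [euv suv]]] := aR eR; exists u, v; split=> // uv.
  have [uV vV] : u \in V /\ v \in V by apply: pairs_ofP rest_V _; rewrite -euv.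
  pose R' := (E `\` L) `\ e.
  have V' : pairs_of V R' by move=> h /sub1/rest_V.
  pose C z := conn R' u z \/ exists2 a, a \in V `&` N /\ conn R' u a &
    z \in N \/ exists2 b, b \in V `&` N & conn R' b z.
  have Cv : C v.
    apply: (conn_closed (C := C)) uv (or_introl (conn_refl _ _)) => z z'.
    rewrite in_fsetD1 in_fsetU => /andP[zz'e /orP[zz'|zz']].
      have zz'R : conn R' z z' by apply: conn1; rewrite in_fsetD1 zz'e.
      have [zV _] := pairs_ofP rest_V zz'.
      case=> [uz|[a [aA ua] zNb]]; first by left; apply: conn_trans zz'R.
      right; exists a => //; right; case: zNb => [zN|[b bA bz]].
        by exists z => //; rewrite inE zV.
      by exists b => //; apply: conn_trans zz'R.
    have [zN z'N] := pairs_ofP NF zz'.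
    case=> [uz|[a aA _]]; last by right; exists a => //; left.
    right; exists z; last by left.
    by split=> //; rewrite inE zN andbT; apply: conn_in V' uz uV.
  have R'R := conn_sub (sub1 e).
  case: Cv => [//|[a [aA ua] vb]].
  have [b bA bv] : exists2 b, b \in V `&` N & conn R' b v.
    case: vb => // vN; exists v; last exact: conn_refl.
    by rewrite inE vV.
  have ab : a = b.
    apply: meet_apart => //; apply: conn_trans (conn_sym (R'R _ _ ua)) _.
    apply: conn_trans (conn_sym (R'R _ _ bv)).
    by apply: conn1; rewrite -euv.
  by apply: suv; apply: conn_trans ua _; rewrite ab.
have [u [v [euv suv]]] := aF _ eF; exists u, v; split=> // uv.
have [uN vN] : u \in N /\ v \in N by apply: pairs_ofP NF _; rewrite -euv.
pose F' := EF `\ e.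
have N' : pairs_of N F' by move=> h /sub2/NF.
pose C z := z \in N /\ conn F' u z \/
  exists2 a, a \in V `&` N & conn F' u a /\ conn (E `\` L) a z.
have Cv : C v.
  apply: (conn_closed (C := C)) uv _; last by left; split=> //; apply: conn_refl.
  move=> z z'; rewrite in_fsetD1 in_fsetU => /andP[zz'e /orP[zz'|zz']].
    have [zV _] := pairs_ofP rest_V zz'.
    case=> [[zN uz]|[a aA [ua az]]]; right.
      by exists z; [rewrite inE zV|split=> //; apply: conn1].
    by exists a => //; split=> //; apply: conn_trans az (conn1 zz').
  have [zN z'N] := pairs_ofP NF zz'.
  have zz'F : conn F' z z' by apply: conn1; rewrite in_fsetD1 zz'e.
  case=> [[_ uz]|[a aA [ua az]]]; left; split=> //.
    exact: conn_trans zz'F.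
  have az' : a = z.
    apply: meet_apart => //; rewrite inE zN andbT.
    exact: conn_in rest_V az (meetV aA).
  by rewrite -az' in zz'F; apply: conn_trans zz'F.
apply: suv; case: Cv => [[]//|[a aA [ua av]]].
have <- // : a = v.
apply: meet_apart => //; rewrite inE vN andbT.
exact: conn_in rest_V av (meetV aA).
Qed.

(** By [meet_apart] and [reach_meet], each component of [E `\` L] contains exactly
    one point of the tree [EF]. *)
Theorem joined_spanning : spanning (V `|` N) joined_tree.
Proof.
have [_ NF cF] := spEF; split=> //.
  move=> e; rewrite inE => /orP[/rest_V|/NF] [u [v [-> uV vV]]];
  by exists u, v; split=> //; rewrite inE (uV, vV) ?orbT.
have subR : {subset E `\` L <= joined_tree} by move=> h hR; rewrite inE hR.
have subF : {subset EF <= joined_tree} by move=> h hF; rewrite inE hF orbT.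
have toN z : z \in V `|` N -> exists2 a, a \in N & conn joined_tree z a.
  rewrite inE => /orP[/reach_meet[a aA za]|zN]; last by exists z => //; apply: conn_refl.
  by exists a; [apply: meetN|apply: conn_sub za].
move=> u v /toN[a aN ua] /toN[b bN vb].
apply: conn_trans ua (conn_trans _ (conn_sym vb)).
exact: conn_sub subF (cF _ _ aN bN).
Qed.


Variables (X : {fset P}) (le : edge P -> edge P -> Prop).
Hypotheses (XV : {subset X <= V}) (lgr_le : forall g h, lgr g h -> le h g).
Hypothesis le_trans : forall f g h, le f g -> le g h -> le f h.
Hypothesis BEF : forall e, e \in B -> e \notin EF.
Hypothesis lightE : light X le E B.

(** Only a chord whose cycle runs through [EF] is new.  The remaining edge [e] on
    that cycle is then shorter than the edge removed between the points where
    the cycle enters and leaves [EF], and this edge was on the old cycle of the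
    same chord. *)
Theorem joined_light : light X le joined_tree (B `\` L).
Proof.
move=> x y e xX yX eBL sxy; move: (eBL); rewrite inE => /andP[eL eB].
have [sE|/NNPP xyE] := classic (sep E e x y); first exact: lightE.
have [aE _ cE] := spE; have [_ NF cF] := spEF.
have FJ a b : a \in V `&` N -> b \in V `&` N -> conn (joined_tree `\ e) a b.
  move=> /meetN aN /meetN bN; apply: conn_sub (cF _ _ aN bN) => h hF.
  by rewrite in_fsetD1 in_fsetU hF orbT andbT; apply: contraTneq hF => ->; apply: BEF.
pose R' := (E `\` L) `\ e.
have RJ c d : conn R' c d -> conn (joined_tree `\ e) c d.
  apply: conn_sub => h /fsetD1P[he hR].
  by rewrite in_fsetD1 he in_fsetU hR.
(* x hangs on a and y on b; if e cuts x off a but not y off b, it lies on the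
   path from a to b, whose longest edge g separates x from y as well *)
have main c d a b : c \in X -> d \in X -> a \in V `&` N -> b \in V `&` N ->
    conn (E `\ e) c d -> conn (E `\` L) c a -> conn (E `\` L) d b ->
    ~ conn R' c a -> conn R' d b -> le e [fset c; d].
  move=> cX dX aA bA cd ca db nca db'.
  have sca := sep_ext aE rest_sub ca nca.
  have R'E : {subset R' <= E `\ e}.
    by move=> h /fsetD1P[he /rest_sub hE]; rewrite in_fsetD1 he.
  have sab : sep E e a b.
    move=> ab; apply: sca; apply: conn_trans cd _.
    exact: conn_trans (conn_sub R'E db') (conn_sym ab).
  have ab : a != b.
    by apply/eqP => ab; apply: sab; rewrite ab; apply: conn_refl.
  have [g gL [gB sg gmax]] := sep_L aA bA ab.
  have RE p q : conn (E `\` L) p q -> conn (E `\ g) p q.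
    apply: conn_sub => h; rewrite !inE => /andP[hL ->]; rewrite andbT.
    by apply: contraNneq hL => ->.
  have scd : sep E g c d.
    move=> cdg; apply: sg; apply: conn_trans (conn_sym (RE _ _ ca)) _.
    exact: conn_trans cdg (RE _ _ db).
  apply: le_trans (lightE cX dX gB scd); apply: lgr_le; apply: gmax => //.
  by apply: contraNneq eL => ->.
have [a aA xa] := reach_meet (XV xX); have [b bA yb] := reach_meet (XV yX).
have [xa'|nxa] := classic (conn R' x a); have [yb'|nyb] := classic (conn R' y b).
- case: sxy; apply: conn_trans (RJ _ _ xa') _.
  exact: conn_trans (FJ _ _ aA bA) (conn_sym (RJ _ _ yb')).
- by rewrite fsetUC; apply: main yb xa nyb xa' => //; apply: conn_sym.
- exact: main xa yb nxa yb'.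
(* e cuts off both, so all four points are connected in E - L *)
have [u [v [euv _]]] := aE _ (BE eB).
have touch c d : conn (E `\` L) c d -> ~ conn R' c d -> conn (E `\` L) c u.
  move=> cd ncd.
  have uvR : conn (E `\` L) u v.
    by apply: conn1; rewrite -euv inE eL BE.
  have R'R : {subset R' <= E `\` L} by move=> h; rewrite in_fsetD1 => /andP[].
  case: (conn_bridge u v cd); rewrite -euv -/R'.
  - by move=> /ncd.
  - by move=> [/(conn_sub R'R)].
  - by move=> [/(conn_sub R'R) cv _]; apply: conn_trans cv (conn_sym uvR).
have xy : conn (E `\` L) x y.
  exact: conn_trans (touch _ _ xa nxa) (conn_sym (touch _ _ yb nyb)).
have nxy : ~ conn R' x y by move=> /RJ.
by case: (sep_ext aE rest_sub xy nxy xyE).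
Qed.

End Contraction.

(** * Light spanning trees are minimal *)

Section Optimality.
Variables (P : choiceType) (R : realType) (w : edge P -> R).
Implicit Types (E F : {fset edge P}) (V X : {fset P}).

Definition weight E : R := (\sum_(e <- E) w e)%R.
Definition no_longer (e f : edge P) : Prop := (w e <= w f)%R.

Lemma weight_swap E e f : e \in E -> f \notin E ->
  weight (f |` E `\ e) = (weight E - w e + w f)%R.
Proof.
move=> eE fE; rewrite /weight big_fsetU1 /=; last by rewrite in_fsetD1 (negPf fE) andbF.
by rewrite (big_fsetD1 e eE) /= [(w e + _)%R]addrC addrK addrC.
Qed.

(** An edge [f] of the other tree [E'] outside [E] closes a cycle with [E], and
    this cycle has an edge [e] joining the two parts of [E' `\ f].
    Being light, [E] has [e] no longer than [f], and trading [f] for [e] brings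
    [E'] closer to [E]. *)
Lemma light_minimal V X F E E' : spanning V E -> spanning V E' ->
  {subset F <= E} -> {subset F <= E'} -> 
  pairs_of X (E `\` F) -> pairs_of X (E' `\` F) ->
  light X no_longer E (E `\` F) -> (weight E <= weight E')%R.
Proof.
move=> spE; have [aE VE cE] := spE => + FE + XE; have [n] := ubnP #|` E' `\` E|.
elim: n => // n IH in E' * => /ltnSE len spE' FE' XE' lightE.
have [aE' VE' cE'] := spE'.
have [E'E|] := boolP (E' `<=` E).
  suff -> : E' = E by [].
  apply/eqP; rewrite eqEfsubset E'E /=; apply/fsubsetP => e eE.
  apply/negPn/negP => eE'; have [u [v [euv suv]]] := aE _ eE.
  have [uV vV] : u \in V /\ v \in V by apply: pairs_ofP VE _; rewrite -euv.
  apply: suv; apply: conn_sub (cE' _ _ uV vV) => h hE'.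
  rewrite in_fsetD1 (fsubsetP E'E)// andbT.
  by apply: contraNneq eE' => <-.
move=> /fsubsetPn[f fE' fE].
have fF : f \notin F by apply: contraNN fE => /FE.
have [x [y [fxy sxy]]] := aE' _ fE'.
have [xX yX] : x \in X /\ y \in X.
  by apply: pairs_ofP XE' _; rewrite -fxy inE fF.
have [xV yV] : x \in V /\ y \in V by apply: pairs_ofP VE' _; rewrite -fxy.
have [K xyK KP] := conn_separators aE (cE _ _ xV yV).
have [e eK] : exists2 e, e \in K & forall u v, e = [fset u; v] -> ~ conn (E' `\ f) u v.
  apply: NNPP => none; apply: sxy; apply: conn_bind xyK => u v uvK.
  apply: NNPP => nuv; apply: none; exists [fset u; v] => // a b /fset2_eq[][<- <-] //.
  by move/conn_sym.
have se := KP _ eK; have eE := sep_mem (cE _ _ xV yV) se => cross.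
have [u [v [euv suv]]] := aE _ eE; have uvE' := cross _ _ euv.
have [uV vV] : u \in V /\ v \in V by apply: pairs_ofP VE _; rewrite -euv.
have ef : e != f by apply: contraNneq fE => <-.
have eE' : e \notin E'.
  apply/negP => eE'; apply: uvE'; apply: conn1.
  by rewrite -euv in_fsetD1 ef.
have eF : e \notin F by apply: contraNN eE' => /FE'.
have le_ef : no_longer e f.
  by rewrite fxy; apply: lightE => //; rewrite inE eF.
have := IH (e |` E' `\ f) _ _ _ _ lightE.
rewrite weight_swap// => le_w.
apply: (le_trans (le_w _ _ _ _)).
- apply: leq_trans len; rewrite [X in _ < X](cardfsD1 f) inE fE' fE /= ltnS.
  apply: fsubset_leq_card; apply/fsubsetP => h; rewrite !inE.
  case: eqVneq => [-> | _]; first by rewrite eE.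
  by case: (h == f); rewrite ?andbF.
- by rewrite euv; apply: spanning_swap.
- move=> h hF; rewrite in_fset1U in_fsetD1 FE' // andbT.
  by rewrite (_ : h != f) ?orbT//; apply: contraTneq hF => ->.
- move=> h; rewrite inE in_fset1U in_fsetD1 => /andP[hF /orP[/eqP hE|/andP[_ hE']]].
    by rewrite hE; apply: XE; rewrite inE eF.
  by apply: XE'; rewrite inE hF.
- by rewrite -addrA gerDl addrC subr_le0.
Qed.

End Optimality.

(** The cycle property: trading an edge for a chord on whose cycle it lies gives
    another spanning tree, which is not shorter. *)
Lemma mst_light (R : realType) (nrm : 'rV[R]_2 -> R) X T : is_mst nrm X T ->
  light X (no_longer (elen nrm)) (edges T) (edges T).
Proof.
move=> [/is_treeP[spT T0 _] XT minT] x y e xX yX eT sxy; rewrite /no_longer.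
rewrite XT in spT T0.
have [xyT|xyT] := boolP ([fset x; y] \in edges T).
  have [-> //|xye] := eqVneq e [fset x; y].
  by case: sxy; apply: conn1; rewrite in_fsetD1 eq_sym xye.
have spG := spanning_swap spT xX yX sxy.
have := minT (X, [fset x; y] |` edges T `\ e); rewrite /total_length.
rewrite -!/(weight (elen nrm) _) weight_swap// -addrA lerDl addrC subr_ge0; apply=> //.
by apply/is_treeP; split=> //; apply: spanning_simple.
Qed.

(** * Results and costs of loops *)

Local Notation In := List.In.

Section LoopRules.
Variables A B : Type.
Implicit Types (s : seq A) (c : nat).

(** Value and cost are handled together because the cost of an iteration often
    depends on an invariant of the loop; [I] speaks of the part of the list that
    has been treated. *)
Lemma for_each_run (I : seq A -> B -> Prop) c f s b0 :
  I [::] b0 ->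
  (forall s1 a s2 b, s = s1 ++ a :: s2 -> I s1 b ->
     I (rcons s1 a) (f a b).2 /\ (f a b).1 <= c) ->
  I s (for_each s f b0).2 /\ (for_each s f b0).1 <= (size s * c.+2).+1.
Proof.
move=> I0 step.
suff main s2 : forall s1 b, s = s1 ++ s2 -> I s1 b ->
    I s (for_each s2 f b).2 /\ (for_each s2 f b).1 <= (size s2 * c.+2).+1.
  exact: (main s [::]).
elim: s2 => [|a s2 IH] s1 b /= sE Ib; first by rewrite sE cats0.
have [Ib' le_c] := step _ _ _ _ sE Ib; rewrite -cat_rcons in sE.
have [Ie le_e] := IH _ _ sE Ib'; split=> //.
by move: le_c le_e; rewrite /bind /=; lia.
Qed.

Lemma first_some_cost c (f : A -> timed (option B)) s :
  (forall a, In a s -> (f a).1 <= c) -> (first_some s f).1 <= (size s * c.+2).+1.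
Proof.
elim: s => //= a s IH le_c; have := le_c a (or_introl erefl).
have := IH (fun b bs => le_c b (or_intror bs)).
by rewrite /bind /=; case: (f a).2 => [b|] /=; lia.
Qed.

Lemma first_some_Some (f : A -> timed (option B)) s b :
  (first_some s f).2 = Some b -> exists2 a, In a s & (f a).2 = Some b.
Proof.
elim: s => //= a s IH; rewrite /bind /=; case fa: (f a).2 => [b'|] /=.
  by move=> [<-]; exists a => //; left.
by move=> /IH[a' a's]; exists a' => //; right.
Qed.

Lemma first_some_None (f : A -> timed (option B)) s :
  (first_some s f).2 = None -> forall a, In a s -> (f a).2 = None.
Proof.
elim: s => //= a s IH; rewrite /bind /=; case fa: (f a).2 => [b'|] //= /IH h.
by move=> a' [<-|/h].
Qed.

Lemma holds_for_all_cost c (f : A -> timed bool) s :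
  (forall a, In a s -> (f a).1 <= c) -> (holds_for_all s f).1 <= (size s * c.+2).+1.
Proof.
elim: s => //= a s IH le_c; have := le_c a (or_introl erefl).
have := IH (fun b bs => le_c b (or_intror bs)).
by rewrite /bind /=; case: (f a).2 => /=; lia.
Qed.

Lemma holds_for_allE (f : A -> timed bool) s :
  (holds_for_all s f).2 = all (fun a => (f a).2) s.
Proof. by elim: s => //= a s IH; rewrite /bind /=; case: (f a).2. Qed.

End LoopRules.

Lemma InP (A : eqType) (a : A) s : In a s <-> a \in s.
Proof.
elim: s => //= b s IH; rewrite inE; split=> [[->|/IH->]|/orP[/eqP->|/IH]];
  by rewrite ?eqxx ?orbT//; auto.
Qed.

Lemma In_mapP A (B : eqType) (f : A -> B) s b :
  b \in map f s <-> exists2 a, In a s & f a = b.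
Proof.
elim: s => [|a s IH] /=; first by split=> // -[].
rewrite inE; split=> [/orP[/eqP->|fb]|[a' [->|a's] fb]].
- by exists a; first left.
- by have [a' a's <-] := IH.1 fb; exists a'; first right.
- by rewrite fb eqxx.
- by apply/orP; right; apply: IH.2; exists a'.
Qed.

Lemma In_rcons A (a b : A) s : In a (rcons s b) -> In a s \/ a = b.
Proof. by elim: s => [[->|[]]|c s IH /= [->|/IH[]]]; auto. Qed.

(** The base [m] exceeds the loop bound [n] by enough to absorb the overhead of
    the iterations into the next power. *)
Lemma loop_power n m s c j : n + 5 <= m -> s <= n -> 0 < j -> c <= m ^ j ->
  (s * c.+2).+1 <= m ^ j.+1.
Proof.
case: j => // j le_m le_s _ le_c; rewrite expnS.
have : m <= m ^ j.+1 by rewrite expnS leq_pmulr// expn_gt0; lia.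
by move: (m ^ j.+1) le_c => M; nia.
Qed.

Lemma power_mono m i j : 5 <= m -> i <= j -> m ^ i <= m ^ j.
Proof. by move=> m5 ij; apply: leq_pexp2l => //; lia. Qed.

(** With [loop_power], this reduces cost estimates to counting: one power of [m]
    for each loop, and one for each sequence of up to five steps. *)
Lemma sum_power m c j : 5 <= m -> c <= 5 * m ^ j -> c <= m ^ j.+1.
Proof. by move=> m5 le_c; rewrite expnS; apply: leq_trans le_c _; rewrite leq_mul2r m5 orbT. Qed.

(** * Breadth-first search *)

Section Search.
Variable P : choiceType.
Variables (EJ : seq (Jedge P)) (VJ : seq (Jnode P)) (n m : nat).
Hypotheses (le_nm : n + 5 <= m) (le_EJ : size EJ <= n) (le_VJ : size VJ <= n).

Definition adjJ u v := exists2 e, In e EJ & across u e = Some v.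

Hypothesis keys_VJ : forall u v, adjJ u v -> v \in map fst VJ.
Hypothesis key0 : 0 \in map fst VJ.

(** A path of [J] without chords is what breadth-first search provides and the
    tree requires.  The list [q] has the last edge of the path first, and [ns]
    lists the nodes of the path before its end [v]. *)
Inductive induced : nat -> seq (Jedge P) -> seq nat -> Prop :=
| induced_nil : induced 0 [::] [::]
| induced_cons u q ns e v : induced u q ns -> In e EJ -> across u e = Some v ->
    v \notin u :: ns -> (forall i, i \in ns -> ~ adjJ i v) ->
    induced v (e :: q) (u :: ns).

Let keys (s : reached P) := map fst s.
Let closed (s : reached P) u := forall v, adjJ u v -> v \in keys s.

(* Between rounds the earlier nodes of each path are closed, so a node entered
   later is adjacent to none of them: this keeps the paths induced. *)
Let entry_ok (s : reached P) (vq : nat * seq (Jedge P)) :=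
  exists ns, [/\ induced vq.1 vq.2 ns, {subset ns <= keys s}
    & forall i, i \in ns -> closed s i].

(* The last clause counts rounds: each one that leaves a frontier has entered
   a new node, so the frontier is empty after as many rounds as there are nodes. *)
Let inv r (st : reached P * reached P) :=
  [/\ [/\ uniq (keys st.2), 0 \in keys st.2 & forall vq, In vq st.2 -> entry_ok st.2 vq],
      exists old, st.2 = st.1 ++ old,
      forall v, v \in keys st.2 -> v \in keys st.1 \/ closed st.2 v
    & st.1 = [::] \/ r < size st.2].

Let keys_in s vq : In vq s -> vq.1 \in keys s.
Proof. by move=> vqs; apply/In_mapP; exists vq. Qed.

Let keys_inP s v : v \in keys s -> exists2 vq, In vq s & vq.1 = v.
Proof. by move/In_mapP. Qed.

Let induced_key v q ns : induced v q ns -> v \in map fst VJ.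
Proof. by case=> // u q' ns' e v' _ eE uv _ _; apply: (keys_VJ (u := u)); exists e. Qed.

Let size_reached (s : reached P) : uniq (keys s) ->
  (forall vq, In vq s -> entry_ok s vq) -> size s <= size VJ.
Proof.
move=> us ok; rewrite -(size_map fst) -[X in _ <= X](size_map fst).
apply: uniq_leq_size => // v /keys_inP[vq /ok[ns [+ _ _]] <-].
exact: induced_key.
Qed.

(* In the course of a round from [fr] and [all], a path that has just been
   entered may have its last but one node in the frontier, not yet closed; the
   nodes [done] are those of the frontier that have been closed. *)
Let mid (fr all : reached P) (done : nat -> Prop) (st : reached P * reached P) :=
  [/\ st.2 = st.1 ++ all, uniq (keys st.2), forall v, done v -> closed st.2 v
    & forall vq, In vq st.1 -> exists ns, [/\ induced vq.1 vq.2 ns,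
        {subset ns <= keys st.2}
      & forall i, i \in ns -> i \in keys fr \/ closed st.2 i]].

Lemma bfs_round_inv r st : inv r st ->
  inv r.+1 (bfs_round EJ st).2 /\ (bfs_round EJ st).1 <= m ^ 5.
Proof.
case: st => fr all [/= [uall all0 ok] [old allE] cl big].
have le_all : size all <= n by apply: leq_trans le_VJ; apply: size_reached.
have le_fr : size fr <= n by apply: leq_trans le_all; rewrite allE size_cat leq_addr.
pose I s := mid fr all (fun v => v \in keys s).
rewrite /bfs_round /=.
set body := (fun up st' => _).
have size_mid d st' : mid fr all d st' -> size st'.2 <= n.
  case=> st'E ust' _ okst'; apply: leq_trans le_VJ.
  rewrite -(size_map fst) -[X in _ <= X](size_map fst).
  apply: uniq_leq_size => // v /keys_inP[vq]; rewrite st'E => /List.in_app_iff[].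
    by move=> /okst'[ns [+ _ _]] <-; apply: induced_key.
  by move=> /ok[ns [+ _ _]] <-; apply: induced_key.
have [||[all'E uall' cl' ok'] cost] := @for_each_run _ _ I (m ^ 4) body fr ([::], all).
- by split.
- move=> s1 [u q] s2 st' frE Ist'.
  have uq_fr : In (u, q) fr by rewrite frE; apply/List.in_app_iff; right; left.
  have uq_all : In (u, q) all by rewrite allE; apply/List.in_app_iff; left.
  have [ns [uq_ind ns_all ns_cl]] := ok _ uq_all.
  pose I' (es : seq (Jedge P)) st'' := mid fr all (fun v => v \in keys s1) st'' /\
    forall e v, In e es -> across u e = Some v -> v \in keys st''.2.
  rewrite /body /=.
  set body' := (fun e st' => _).
  have [||[[st''E ust'' d'' ok''] nb] cost] := @for_each_run _ _ I' (m ^ 3) body' EJ st'.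
  + by split.
  + move=> es1 e es2 [new all'] EJE [mid' nb].
    have eEJ : In e EJ by rewrite EJE; apply/List.in_app_iff; right; left.
    have [/= all'E uall' cl' ok'] := mid'.
    rewrite /body'; case uv: (across u e) => [v|] /=; last first.
      split; last by rewrite expn_gt0; lia.
      split=> // e' v' e'es; case: (In_rcons e'es) => [{}e'es|->]; first exact: nb e'es.
      by rewrite uv.
    set look := first_some _ _.
    have cost_look : look.1 <= m ^ 2.
      have : size all' <= n by apply: size_mid mid'.
      move=> le_all'; apply: leq_trans (first_some_cost (c := 1) _) _ => //.
      by apply: (loop_power (c := 1) le_nm le_all') => //; rewrite expn_gt0; lia.
    split; last by apply: sum_power; lia.
    case lk: look.2 => [t|] /=.
      have [vq vq_all'] := first_some_Some lk; case: eqP => //= vE _.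
      split=> // e' v' e'es; case: (In_rcons e'es) => [{}e'es|->]; first exact: nb e'es.
      by rewrite uv => -[<-]; rewrite -vE; apply: keys_in.
    have v_new : v \notin keys all'.
      apply/negP => /keys_inP[vq vq_all' vE].
      by have := first_some_None lk vq_all'; rewrite /= vE eqxx.
    have up : {subset keys all' <= keys ((v, e :: q) :: all')}.
      by move=> i; rewrite inE orbC => ->.
    have cl_up i : closed all' i -> closed ((v, e :: q) :: all') i.
      by move=> + k ik => /(_ _ ik)/up.
    have all_all' : {subset keys all <= keys all'}.
      by move=> i; rewrite all'E /keys map_cat mem_cat orbC => ->.
    split; last first.
      move=> e' v' e'es; case: (In_rcons e'es) => [{}e'es|->] /=; first by move=> /(nb _ _ e'es)/up.
      by rewrite uv => -[->]; rewrite inE eqxx.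
    split=> //=; first by rewrite all'E.
    - by rewrite v_new.
    - by move=> i /cl'/cl_up.
    move=> vq [<-|/ok'[ns' [ind' ns'_sub ns'_cl]]]; last first.
      exists ns'; split=> // [i /ns'_sub/up//|i /ns'_cl[]]; first by left.
      by move/cl_up; right.
    exists (u :: ns); split=> /=.
    + apply: induced_cons uq_ind eEJ uv _ _.
        rewrite inE negb_or; apply/andP; split.
          by apply: contraNneq v_new => ->; apply/all_all'/(keys_in uq_all).
        by apply: contraNN v_new => /ns_all/all_all'.
      by move=> i ins /(ns_cl i ins)/all_all'; rewrite (negPf v_new).
    + move=> i; rewrite inE => /orP[/eqP->|/ns_all/all_all'/up//].
      by apply/up/all_all'/(keys_in uq_all).
    + move=> i; rewrite inE => /orP[/eqP->|ins]; first by left; apply: (keys_in uq_fr).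
      by right; apply: cl_up => k /(ns_cl i ins)/all_all'.
  split; last by apply: leq_trans cost (loop_power le_nm le_EJ _ _).
  split=> // i; rewrite /keys map_rcons mem_rcons inE => /orP[/eqP->|/d''//].
  by move=> v [e eEJ uv]; apply: nb uv.
have fr0 : fr = [::] -> (for_each fr body ([::], all)).2.1 = [::] by move=> ->.
set res := (for_each _ _ _).2 in all'E uall' cl' ok' fr0 *.
move: res all'E uall' cl' ok' fr0 cost => [new all'] /= all'E uall' cl' ok' fr0 cost.
split; last by apply: leq_trans cost (loop_power le_nm le_fr _ _).
have all_all' : {subset keys all <= keys all'}.
  by move=> i; rewrite all'E /keys map_cat mem_cat orbC => ->.
split=> /=.
- split=> //; first exact: all_all'.
  move=> vq; rewrite {1}all'E => /List.in_app_iff[/ok'|/ok] [ns [ind sub nsc]];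
    exists ns; split=> //.
  + by move=> i /nsc[/cl'|].
  + by move=> i /sub/all_all'.
  + by move=> i /nsc nc k /nc/all_all'.
- by exists all.
- move=> v; rewrite all'E /keys map_cat mem_cat => /orP[vnew|/cl[/cl'|nc]].
  + by left.
  + by right; rewrite -all'E.
  + by right => k /nc/all_all'; rewrite all'E.
case: big => [/fr0->|big]; first by left.
case: (new) all'E => [|vq new'] ->; first by left.
by right; rewrite size_cat /=; lia.
Qed.

(** Failure is witnessed by a set of nodes that no edge leaves, the nodes
    reached. *)
Lemma search_run : let r := search VJ EJ in
  match r.2 with
  | Some q => exists ns, induced 1 q ns
  | None => exists Z : seq nat, [/\ 0 \in Z, 1 \notin Z
      & forall u v, u \in Z -> adjJ u v -> v \in Z]
  end /\ r.1 <= m ^ 7.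
Proof.
rewrite /search /= /bind /=.
set body := (fun _ st => _).
have [||] := @for_each_run _ _ (fun s => inv (size s)) (m ^ 5) body VJ
    ([:: (0, [::])], [:: (0, [::])]).
- split=> /=; [split=> //|by exists [::]|by move=> v; left|by right].
  move=> vq [<-|//]; exists [::]; split=> //; exact: induced_nil.
- move=> s1 a s2 st _ Ist; rewrite size_rcons; exact: bfs_round_inv.
set res := for_each _ _ _; case: (res.2) => fr all [/= [uall all0 ok] [old allE] cl big] cost.
have le_all := size_reached uall ok.
have fr0 : fr = [::] by case: big => //; lia.
set look := first_some _ _.
have cost_look : look.1 <= m ^ 2.
  apply: leq_trans (first_some_cost (c := 1) _) _ => //.
  by apply: (loop_power (c := 1) le_nm) => //; [lia|rewrite expn_gt0; lia].
have cost' : res.1 <= m ^ 6 by apply: leq_trans cost (loop_power le_nm le_VJ _ _).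
split; last first.
  have m5 : 5 <= m by lia.
  have := power_mono m5 (isT : 2 <= 6) => le26; apply: sum_power => //.
  by apply: leq_trans (leq_add cost' (leq_trans cost_look le26)) _; lia.
case lk: look.2 => [q|].
  have [[v q'] vq_all /=] := first_some_Some lk; case: eqP => // v1 [<-].
  by have [ns [+ _ _]] := ok _ vq_all; rewrite /= v1; exists ns.
exists (keys all); split=> //.
  apply/negP => /keys_inP[vq vq_all vE].
  by have := first_some_None lk vq_all; rewrite /= vE.
by move=> u v /cl[|]; [rewrite fr0|apply].
Qed.

End Search.

(** * The graph [J] and its paths *)

Lemma for_each_op A B (f : A -> B -> B) s b :
  (for_each s (fun a b => op (f a b)) b).2 = foldl (fun b a => f a b) b s /\
  (for_each s (fun a b => op (f a b)) b).1 <= (size s * 3).+1.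
Proof.
elim: s b => //= a s IH b; have [-> le_c] := IH (f a b).
by split=> //; move: le_c; rewrite /bind /=; lia.
Qed.

(** Both the construction of [J] and the treatment of all pairs collect optional
    results in a double loop. *)
Lemma collect_run A B C (f : A -> B -> seq C -> timed (seq C))
    (g : A -> B -> option C) c s s' :
  (forall a b L, In a s -> In b s' ->
     (f a b L).2 = (if g a b is Some x then x :: L else L) /\ (f a b L).1 <= c) ->
  let r := for_each s (fun a L => for_each s' (f a) L) [::] in
  [/\ forall x, In x r.2 <-> exists a b, [/\ In a s, In b s' & g a b = Some x],
      size r.2 <= size s * size s'
    & r.1 <= (size s * (size s' * c.+2).+3).+1].
Proof.
move=> fg r.
pose I s1 (L : seq C) := (forall x, In x L <->
   exists a b, [/\ In a s1, In b s' & g a b = Some x]) /\ size L <= size s1 * size s'.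
have [||[rE sz] cost] := @for_each_run _ _ I (size s' * c.+2).+1
    (fun a L => for_each s' (f a) L) s [::].
- by split=> //= x; split=> // -[a [b []]].
- move=> s1 a s2 L sE [LE szL].
  have a_s : In a s by rewrite sE; apply/List.in_app_iff; right; left.
  pose I' t (L' : seq C) := (forall x, In x L' <-> In x L \/
     exists2 b, In b t & g a b = Some x) /\ size L' <= size L + size t.
  have [||[L'E szL'] cost'] := @for_each_run _ _ I' c (f a) s' L.
  + by split; rewrite ?addn0// => x; split=> [|[//|[b []]]]; left.
  + move=> t1 b t2 L1 s'E [L1E szL1].
    have b_s : In b s' by rewrite s'E; apply/List.in_app_iff; right; left.
    have [-> le_c] := fg a b L1 a_s b_s; split=> //; split; last first.
      by rewrite size_rcons; case: (g a b) => [x|] /=; lia.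
    have t1P b' : In b' (rcons t1 b) <-> In b' t1 \/ b' = b.
      split; first exact: In_rcons.
      rewrite -cats1 => h; apply/List.in_app_iff.
      by case: h => [|->]; [left|right; left].
    move=> x; case gab: (g a b) => [y|] /=; rewrite L1E; split.
    * move=> [<-|[xL|[b' b't gb']]]; [right; exists b|left|right; exists b'] => //;
        by apply/t1P; auto.
    * move=> [|[b' /t1P[b't|->] gb']]; first by auto.
        by right; right; exists b'.
      by left; move: gb'; rewrite gab => -[].
    * move=> [|[b' b't gb']]; first by auto.
      by right; exists b' => //; apply/t1P; left.
    * move=> [|[b' /t1P[b't|->] gb']]; [by auto|by right; exists b'|].
      by move: gb'; rewrite gab.
  split=> //; split; last by rewrite size_rcons; lia.
  have s1P a' : In a' (rcons s1 a) <-> In a' s1 \/ a' = a.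
    split; first exact: In_rcons.
    rewrite -cats1 => h; apply/List.in_app_iff.
    by case: h => [|->]; [left|right; left].
  move=> x; rewrite L'E LE; split.
    move=> [[a' [b [a's bs gx]]]|[b bs gx]]; [exists a', b|exists a, b]; split=> //;
      by apply/s1P; auto.
  move=> [a' [b [/s1P[a's|->] bs gx]]]; [left|right; exists b] => //.
  by exists a', b.
by split.
Qed.

Section Witnesses.
Variables (P : choiceType) (H : edge P -> P -> P -> bool) (D : seq (edge P)).
Variables (n m : nat).
Hypotheses (le_nm : n + 5 <= m) (le_D : size D <= n).

Definition unsplit_by w w' := all (fun e => ~~ H e w w') D.

Lemma find_witness_run U U' : size U <= n -> size U' <= n ->
  let r := find_witness H D U U' in
  match r.2 with
  | Some (w, w') => [/\ w \in U, w' \in U' & unsplit_by w w']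
  | None => forall w w', w \in U -> w' \in U' -> ~~ unsplit_by w w'
  end /\ r.1 <= m ^ 5.
Proof.
move=> le_U le_U' r; split; last first.
  apply: leq_trans (first_some_cost (c := m ^ 4) _) (loop_power le_nm le_U _ _) => // w _.
  apply: leq_trans (first_some_cost (c := m ^ 3) _) (loop_power le_nm le_U' _ _) => // w' _.
  rewrite /bind /=; apply: (@sum_power _ _ 2); first lia.
  have : 1 <= m ^ 2 by rewrite expn_gt0; lia.
  have : (holds_for_all D (fun e => op (~~ H e w w'))).1 <= m ^ 2.
    apply: leq_trans (holds_for_all_cost (c := 1) _) _ => //.
    by apply: (loop_power (c := 1) le_nm) => //; rewrite expn_gt0; lia.
  by lia.
rewrite /r /find_witness.
case E1: (first_some _ _).2 => [[w w']|].
  have [w1 w1U E2] := first_some_Some E1; have [w2 w2U] := first_some_Some E2.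
  move/InP: w1U => w1U; move/InP: w2U => w2U.
  by rewrite /bind /= holds_for_allE /=; case: ifP => // ok [<- <-].
move=> w w' /InP wU /InP w'U.
have := first_some_None (first_some_None E1 wU) w'U.
by rewrite /bind /= holds_for_allE /= /unsplit_by; case: all.
Qed.

Lemma build_J_run (VJ : seq (Jnode P)) : size VJ * size VJ <= n ->
  (forall U, In U VJ -> size U.2 <= n) ->
  let r := build_J H VJ D in
  [/\ forall e, In e r.2 -> exists U U' w w', [/\ In U VJ, In U' VJ, U.1 < U'.1,
        [/\ w \in U.2, w' \in U'.2 & unsplit_by w w'] & e = MkJedge U.1 U'.1 w w'],
      forall U U' w w', In U VJ -> In U' VJ -> U.1 < U'.1 ->
        w \in U.2 -> w' \in U'.2 -> unsplit_by w w' ->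
        exists2 e, In e r.2 & end1 e = U.1 /\ end2 e = U'.1,
      size r.2 <= n & r.1 <= m ^ 8].
Proof.
move=> le_VJ le_U r.
have le_VJ1 : size VJ <= n.
  by apply: leq_trans le_VJ; case: (VJ) => //= U s; rewrite leq_pmulr.
pose g (U U' : Jnode P) := if U.1 < U'.1 then
  if (find_witness H D U.2 U'.2).2 is Some (w, w') then Some (MkJedge U.1 U'.1 w w')
  else None else None.
set f := (fun U U' (es : seq (Jedge P)) => if U.1 < U'.1 then
      let* r := find_witness H D U.2 U'.2 in
      op (if r is Some (w, w') then MkJedge U.1 U'.1 w w' :: es else es)
    else op es).
have [|rE sz cost] := @collect_run _ _ _ f g (m ^ 6) VJ VJ.
  move=> U U' es UV U'V; rewrite /f /g; case: ifP => _; last first.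
    by split=> //=; rewrite expn_gt0; lia.
  have [_ le_c] := find_witness_run (le_U _ UV) (le_U _ U'V).
  rewrite /bind /=; split; first by case: (find_witness _ _ _ _).2 => [[w w']|].
  by apply: sum_power; lia.
split.
- move=> e /rE[U [U' [UV U'V]]]; rewrite /g; case: ifP => // UU'.
  have [+ _] := find_witness_run (le_U _ UV) (le_U _ U'V).
  case: (find_witness _ _ _ _).2 => // -[w w'] ok [<-].
  by exists U, U', w, w'.
- move=> U U' w w' UV U'V UU' wU wU' ok.
  have [+ _] := find_witness_run (le_U _ UV) (le_U _ U'V).
  case fw: (find_witness H D U.2 U'.2).2 => [[w1 w1']|] wok; last first.
    by have := wok _ _ wU wU'; rewrite ok.
  exists (MkJedge U.1 U'.1 w1 w1') => //; apply/rE; exists U, U'; split=> //.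
  by rewrite /g UU' fw.
- exact: leq_trans sz le_VJ.
- apply: leq_trans cost _; apply: (loop_power le_nm le_VJ1) => //.
  by apply: (loop_power (c := m ^ 6) le_nm le_VJ1).
Qed.

End Witnesses.

Section LongestOn.
Variables (P : choiceType) (ell : P -> P -> edge P) (lgr : rel (edge P)).
Variable B : {fset edge P}.
Hypotheses (lgr_trans : transitive lgr)
  (lgr_total : {in B &, forall e f, e != f -> lgr e f || lgr f e}).

Lemma longest_on_run q : (forall e, In e q -> ell (sigma1 e) (sigma2 e) \in B) ->
  let r := longest_on ell lgr q in
  match r.2 with
  | Some g => exists2 e, In e q & g = ell (sigma1 e) (sigma2 e) /\
      forall e', In e' q -> let h := ell (sigma1 e') (sigma2 e') in h != g -> lgr g h
  | None => q = [::]
  end /\ r.1 <= (size q * 4).+1.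
Proof.
move=> qB; pose l (e : Jedge P) := ell (sigma1 e) (sigma2 e).
pose I (s : seq (Jedge P)) best := match best with
  | Some g => exists2 e, In e s & g = l e /\ forall e', In e' s -> l e' != g -> lgr g (l e')
  | None => s = [::] end.
set f := (fun e best => let* f := op (ell (sigma1 e) (sigma2 e)) in
    op (if best is Some g then (if lgr f g then Some f else Some g)
        else Some f)).
have [||//] := @for_each_run _ _ I 2 f q None; first by [].
move=> s1 e s2 best qE Ib; split; last by [].
have e_q : In e q by rewrite qE; apply/List.in_app_iff; right; left.
have in_s1 e' : In e' s1 -> In e' (rcons s1 e).
  by move=> h; rewrite -cats1; apply/List.in_app_iff; left.
have e_s1 : In e (rcons s1 e) by rewrite -cats1; apply/List.in_app_iff; right; left.
rewrite /= -/(l e); case: best Ib => [g|] /= => [[e1 e1s [gE gmax]]|->]; last first.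
  exists e; first by left.
  by split=> // e' [<-|//]; rewrite eqxx.
have e1_q : In e1 q by rewrite qE; apply/List.in_app_iff; left.
case: ifP => [eg|neg].
  exists e => //; split=> // e' h; case: (In_rcons h) => [e's|->]; last by rewrite eqxx.
  have [->//|ne _] := eqVneq (l e') g.
  exact: lgr_trans eg (gmax _ e's ne).
exists e1; first exact: in_s1.
split=> // e' h; case: (In_rcons h) => [e's|-> ne]; first exact: gmax.
have := lgr_total (qB _ e_q) (qB _ e1_q); rewrite -/(l e) -/(l e1) -gE.
by move=> /(_ ne); rewrite neg.
Qed.

End LongestOn.

(** * The edge found for a pair of terminals *)

Section Pair.
Variables (P : choiceType) (X : {fset P}) (ET : {fset edge P}).
Variables (ell : P -> P -> edge P) (H : edge P -> P -> P -> bool) (lgr : rel (edge P)).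
Hypotheses (spT : spanning X ET) (lgr_trans : transitive lgr)
  (lgr_total : {in ET &, forall e f, e != f -> lgr e f || lgr f e}).
Hypothesis ellP : forall x y, x != y -> x \in X -> y \in X ->
  longest_sep lgr ET ET (ell x y) x y.
Hypothesis HP : forall e x y, e \in ET -> x \in X -> y \in X ->
  H e x y <-> sep ET e x y.

Variables (Nd : nat -> {fset P}) (Ed : nat -> {fset edge P}).
Variables (As : seq (Jnode P)) (D : seq (edge P)) (E : {fset edge P}) (x y : P).
Let js := map fst As.
Let B := ET `\` [fset e in D].
Hypothesis As_ok : forall U, In U As -> 1 < U.1 /\ U.2 =i X `&` Nd U.1.
Hypothesis spN : forall j, j \in js -> spanning (Nd j) (Ed j).
Hypothesis Nd_inj : forall i j z, i \in js -> j \in js ->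
  z \in Nd i -> z \in Nd j -> i = j.
Hypothesis Ed_new : forall j e, j \in js -> e \in Ed j -> e \notin ET.
Hypothesis D_ET : {subset D <= ET}.
Hypothesis E_ok : forall e, e \in E <-> e \in B \/ exists2 j, j \in js & e \in Ed j.
Hypotheses (aE : acyclic E) (xyE : conn E x y).
Hypotheses (xX : x \in X) (yX : y \in X) (xy : x != y).
Hypotheses (x_new : forall j, j \in js -> x \notin Nd j)
  (y_new : forall j, j \in js -> y \notin Nd j).

Let BET : {subset B <= ET}.
Proof. by move=> e; rewrite inE => /andP[]. Qed.

Let BE : {subset B <= E}.
Proof. by move=> e eB; apply/E_ok; left. Qed.

Let aT : acyclic ET. Proof. by case: spT. Qed.
Let XT : pairs_of X ET. Proof. by case: spT. Qed.
Let XB : pairs_of X B. Proof. by move=> e /BET/XT. Qed.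

Let unsplitP w w' : w \in X -> w' \in X -> unsplit_by H D w w' <-> conn B w w'.
Proof.
move=> wX w'X; have [_ _ cT] := spT; split=> [/allP unsplit|ww'].
  have [K wwK KP] := conn_separators aT (cT _ _ wX w'X).
  apply: conn_sub wwK => e /KP s; have eT := sep_mem (cT _ _ wX w'X) s.
  rewrite !inE eT andbT; apply/negP => /unsplit.
  by rewrite ((HP eT wX w'X).2 s).
apply/allP => e eD; apply/negP => /(HP (D_ET eD) wX w'X); apply.
apply: conn_sub ww' => h; rewrite !inE => /andP[hD ->]; rewrite andbT.
by apply: contraNneq hD => ->.
Qed.

Let VJ : seq (Jnode P) := (0, [:: x]) :: (1, [:: y]) :: As.

(* the point set of the node of J numbered i; nodes of J are compared by their
   numbers, so the lists standing for them must not matter *)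
Let points i := if i == 0 then [fset x] else if i == 1 then [fset y] else X `&` Nd i.

Let points_VJ U : In U VJ -> U.2 =i points U.1.
Proof.
move=> [<-|[<-|/As_ok[U2 UE]]] z; rewrite /points ?inE//=.
by case: (U.1) U2 UE => [|[|j]].
Qed.

Let points_X i z : z \in points i -> z \in X.
Proof.
rewrite /points; case: ifP => _; first by rewrite inE => /eqP->.
by case: ifP => _; rewrite !inE; [move/eqP->|case/andP].
Qed.

Let in_VJ i : i \in map fst VJ -> exists2 U, In U VJ & U.1 = i.
Proof. by move/In_mapP. Qed.

Let points_js i z : i \in map fst VJ -> z \in points i ->
  [\/ i = 0 /\ z = x, i = 1 /\ z = y | [/\ i \in js, 1 < i & z \in Nd i]].
Proof.
rewrite !inE /points => /or3P[/eqP->|/eqP->|ij] /=.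
- by rewrite inE => /eqP->; apply: Or31.
- by rewrite inE => /eqP->; apply: Or32.
have [U UA Ui] : exists2 U, In U As & U.1 = i.
  by apply/In_mapP.
have [i1 _] := As_ok UA; rewrite Ui in i1.
by case: (i) i1 ij => [|[|k]]//= _ ij; rewrite inE => /andP[_ zN]; apply: Or33.
Qed.

Let points_inj i j z : i \in map fst VJ -> j \in map fst VJ ->
  z \in points i -> z \in points j -> i = j.
Proof.
move=> iV jV zi zj.
case: (points_js iV zi) => [[-> zE]|[-> zE]|[ij i1 zN]];
case: (points_js jV zj) => [[-> zE']|[-> zE']|[jj j1 zN']] //; try subst z.
- by case/eqP: (xy).
- by have := x_new jj; rewrite zN'.
- by case/eqP: (xy).
- by have := y_new jj; rewrite zN'.
- by have := x_new ij; rewrite zN.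
- by have := y_new ij; rewrite zN.
exact: Nd_inj zN zN'.
Qed.

(* the points of one node of J are joined by edges that are never removed *)
Let points_conn i z z' g : i \in map fst VJ -> z \in points i -> z' \in points i ->
  g \in ET -> conn (E `\ g) z z'.
Proof.
move=> iV zi z'i gT.
case: (points_js iV zi) => [[iE zE]|[iE zE]|[ij i1 zN]].
- by move: z'i; rewrite iE zE inE => /eqP->; apply: conn_refl.
- by move: z'i; rewrite iE zE inE => /eqP->; apply: conn_refl.
case: (points_js iV z'i) => [[iE zE]|[iE zE]|[_ _ z'N]]; try by rewrite iE in i1.
have [_ _ cN] := spN ij; apply: conn_sub (cN _ _ zN z'N) => h hE.
rewrite in_fsetD1; apply/andP; split; last by apply/E_ok; right; exists i.
by apply: contraTneq gT => <-; apply: Ed_new ij hE.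
Qed.

Let linked i j := [/\ i \in map fst VJ, j \in map fst VJ, i != j &
  exists w w', [/\ w \in points i, w' \in points j & conn B w w']].

Variables n m : nat.
Hypotheses (le_nm : n + 5 <= m) (le_D : size D <= n) (n_gt0 : 0 < n).
Hypotheses (le_As : (size As + 2) * (size As + 2) <= n)
  (le_A : forall U, In U As -> size U.2 <= n).

Let EJ := (build_J H VJ D).2.

Let size_VJ : size VJ = size As + 2.
Proof. by rewrite /= addn2. Qed.

Let EJ_run := @build_J_run P H D n m le_nm le_D VJ.

Let le_VJ2 : size VJ * size VJ <= n. Proof. by rewrite size_VJ. Qed.
Let le_VJU U : In U VJ -> size U.2 <= n.
Proof. by move=> [<-|[<-|/le_A]]. Qed.

Let EJP e : In e EJ -> linked (end1 e) (end2 e) /\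
  [/\ sigma1 e \in points (end1 e), sigma2 e \in points (end2 e)
    & conn B (sigma1 e) (sigma2 e)].
Proof.
have [snd _ _ _] := EJ_run le_VJ2 le_VJU.
move=> /snd[U [U' [w [w' [UV U'V lt [wU w'U' ok] ->]]]]] /=.
have wp : w \in points U.1 by rewrite -points_VJ.
have w'p : w' \in points U'.1 by rewrite -points_VJ.
have ww' : conn B w w' by apply/unsplitP; rewrite ?(points_X wp) ?(points_X w'p).
split=> //; split; last by exists w, w'.
- by apply/In_mapP; exists U.
- by apply/In_mapP; exists U'.
- by rewrite neq_ltn lt.
Qed.

Let linked_sym i j : linked i j -> linked j i.
Proof.
move=> [iV jV ij [w [w' [wi w'j ww']]]]; split=> //; first by rewrite eq_sym.
by exists w', w; split=> //; apply: conn_sym.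
Qed.

Let adj_linked i j : adjJ EJ i j <-> linked i j.
Proof.
split=> [[e /EJP[lk _]]|].
  rewrite /across; case: eqP => [<- [<-]//|_].
  by case: eqP => // <- [<-]; apply: linked_sym.
have up a b : linked a b -> a < b -> exists2 e, In e EJ & end1 e = a /\ end2 e = b.
  have [_ cpl _ _] := EJ_run le_VJ2 le_VJU.
  move=> [/in_VJ[U UV <-] /in_VJ[U' U'V <-] _ [w [w' [wU w'U' ww']]]] ab.
  apply: (cpl _ _ w w') => //; rewrite ?points_VJ//.
  by apply/unsplitP; rewrite ?(points_X wU) ?(points_X w'U').
move=> lk; have [_ _ ij _] := lk; case: (ltngtP i j) => [lt|gt|eq].
- have [e eE [e1 e2]] := up _ _ lk lt; exists e => //.
  by rewrite /across e1 eqxx e2.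
- have [e eE [e1 e2]] := up _ _ (linked_sym lk) gt; exists e => //.
  by rewrite /across e1 e2 eqxx eq_sym (negPf ij).
- by rewrite eq eqxx in ij.
Qed.

(* An edge e of J stands for the path of T between its two sigmas, all of which
   remains in the current tree; g is one of the edges of that path. *)
Let crosses g (e : Jedge P) := sep B g (sigma1 e) (sigma2 e).

Let across_points u v e : In e EJ -> across u e = Some v ->
  exists w w', [/\ w \in points u, w' \in points v, conn B w w'
    & forall g, crosses g e <-> sep B g w w'].
Proof.
move=> /EJP[_ [s1 s2 s12]]; rewrite /across.
case: eqP => [<- [<-]|_]; first by exists (sigma1 e), (sigma2 e).
case: eqP => // <- [<-]; exists (sigma2 e), (sigma1 e); split=> //.
  exact: conn_sym.
by move=> g; split=> s /conn_sym.
Qed.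

(* The origin of an earlier edge of the path is a node other than the last one,
   hence without a chord to nodes that come later. *)
Let origin u q ns e : induced EJ u q ns -> In e q ->
  exists2 i, i \in ns & exists w w', [/\ w \in points i, conn B w w'
    & forall g, crosses g e <-> sep B g w w'].
Proof.
elim=> // {}u {}q {}ns e' v _ IH e'E uv _ _ [<-|/IH[i ins P']]; last first.
  by exists i => //; rewrite inE ins orbT.
exists u; first by rewrite inE eqxx.
have [w [w' [wu _ ww' cr]]] := across_points e'E uv.
by exists w, w'.
Qed.

Let touch w w' a b : conn B w w' -> sep B [fset a; b] w w' -> conn B w a.
Proof.
move=> ww' s; have ab := conn1 (sep_mem ww' s).
case: (conn_bridge a b ww') => [//|[/conn_del //]|[/conn_del wb _]].
exact: conn_trans wb (conn_sym ab).
Qed.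

Let induced_VJ v q ns : induced EJ v q ns -> v \in map fst VJ /\ {subset ns <= map fst VJ}.
Proof.
elim=> [|u {}q {}ns e {}v _ [uV nsV] eE uv _ _]; first by split.
have [|_ vV _ _] := (adj_linked u v).1; first by exists e.
split=> // i; rewrite [i \in _ :: _]inE => /orP[/eqP->|/nsV] //.
Qed.

(** Two stretches of an induced path of [J] run in different components of the
    forest of remaining tree edges, or the path would have a chord.  So [g] is
    used at most once, and a walk using an edge of a tree once separates its
    ends by that edge. *)
Let induced_crosses v q ns g w : induced EJ v q ns -> g \in B -> w \in points v ->
  ((forall e, In e q -> ~ crosses g e) -> conn (E `\ g) x w) /\
  ((exists2 e, In e q & crosses g e) -> sep E g x w).
Proof.
move=> ind gB; have gT := BET gB.
elim: ind w => [|u {}q {}ns e {}v ind IH eE uv v_new nadj] w.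
  rewrite /points /= inE => /eqP->; split; first by move=> _; apply: conn_refl.
  by move=> [].
move=> wv; have [s [s' [su s'v ss' cr]]] := across_points eE uv.
have [|_ vV _ _] := (adj_linked u v).1; first by exists e.
have s'w := points_conn vV s'v wv gT.
have [IH1 IH2] := IH _ su.
have Bg : conn (B `\ g) s s' -> conn (E `\ g) s s'.
  by apply: conn_sub => h /fsetD1P[hg hB]; rewrite in_fsetD1 hg BE.
have [sg|ng] := classic (crosses g e); last first.
  have ss'g : conn (E `\ g) s s' by apply: Bg; apply: NNPP => s_g; apply: ng; apply/cr.
  split=> [none|[e' [<-//|e'q] cr']].
    apply: conn_trans (conn_trans ss'g s'w); apply: IH1 => e' e'q.
    by apply: none; right.
  move=> xw; apply: IH2; first by exists e'.
  by apply: conn_trans xw (conn_sym (conn_trans ss'g s'w)).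
split=> [none|_]; first by case: (none e); first by left.
have sB := (cr g).1 sg; have sE := sep_ext aE BE ss' sB.
have xs : conn (E `\ g) x s.
  apply: IH1 => e' e'q cr'; have [i ins [p [p' [pi pp' /(_ g)[/(_ cr') sp _]]]]] := origin ind e'q.
  apply: (nadj i ins); apply/adj_linked; split=> //.
  - by case: (induced_VJ ind) => _; apply.
  - by apply: contraNneq v_new => <-; rewrite inE ins orbT.
  exists p, s'; split=> //.
  have [a [b [gab _]]] := aT gT; rewrite gab in sB sp.
  apply: conn_trans (touch pp' sp) (conn_trans _ ss').
  exact: conn_sym (touch ss' sB).
move=> xw; apply: sE; apply: conn_trans (conn_sym xs) (conn_trans xw (conn_sym s'w)).
Qed.

Let x0 : x \in points 0. Proof. by rewrite /points inE. Qed.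
Let y1 : y \in points 1. Proof. by rewrite /points inE. Qed.

(** [J] is connected because the tree is: along a walk of the tree, the points
    hanging on the nodes reached in [J] are never left. *)
Let J_connected (Z : seq nat) : 0 \in Z -> (forall u v, u \in Z -> adjJ EJ u v -> v \in Z) ->
  1 \in Z.
Proof.
move=> Z0 Zcl.
have Zlink i j w w' : i \in Z -> i \in map fst VJ -> j \in map fst VJ ->
    w \in points i -> w' \in points j -> conn B w w' -> j \in Z.
  move=> iZ iV jV wi w'j ww'; have [<-//|ij] := eqVneq i j.
  apply: Zcl iZ _; apply/adj_linked; split=> //; by exists w, w'.
have jsV j : j \in js -> j \in map fst VJ by move=> jj; rewrite !inE jj !orbT.
have js_points j z : j \in js -> z \in X -> z \in Nd j -> z \in points j.
  move=> jj zX zN; rewrite /points; have [U UA Uj] : exists2 U, In U As & U.1 = j by apply/In_mapP.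
  have [+ _] := As_ok UA; rewrite Uj.
  by case: (j) zN => [|[|k]] // zN _; rewrite inE zX.
pose C z := (exists i w, [/\ i \in Z, i \in map fst VJ, w \in points i & conn B w z])
  \/ exists2 j, j \in js & j \in Z /\ z \in Nd j.
have Cy : C y.
  apply: (conn_closed (C := C)) xyE _; last first.
    by left; exists 0, x; split=> //; apply: conn_refl.
  move=> z z' /E_ok[zz'|[l lj zz']].
    have [zX z'X] := pairs_ofP XB zz'.
    case=> [[i [w [iZ iV wi wz]]]|[j jj [jZ zN]]]; left.
      by exists i, w; split=> //; apply: conn_trans wz (conn1 zz').
    by exists j, z; split; rewrite ?jsV ?js_points//; apply: conn1.
  have [_ NE _] := spN lj; have [zN z'N] := pairs_ofP NE zz'.
  move=> Cz; right; exists l => //; split=> //.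
  case: Cz => [[i [w [iZ iV wi wz]]]|[j jj [jZ zNj]]]; last by rewrite (Nd_inj lj jj zN zNj).
  have zX := conn_in XB wz (points_X wi).
  exact: Zlink iZ iV (jsV _ lj) wi (js_points _ _ lj zX zN) wz.
case: Cy => [[i [w [iZ iV wi wy]]]|[j jj [_]]]; last by rewrite (negPf (y_new jj)).
by apply: (Zlink i 1 w y).
Qed.

Let induced_size v q ns : induced EJ v q ns -> size q <= size VJ.
Proof.
move=> ind; have [_ nsV] := induced_VJ ind.
have [<- uns] : size ns = size q /\ uniq ns.
  suff [] : size ns = size q /\ uniq (v :: ns) by move=> ? /andP[].
  elim: ind {nsV} => [//|u {}q {}ns e {}v ind' [IH uns] _ _ v_new _].
  by split; rewrite /= ?IH//; apply/andP.
rewrite -[X in _ <= X](size_map fst); exact: uniq_leq_size.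
Qed.

(** By [induced_crosses] the remaining edges on the path of the current tree from
    [x] to [y] are the edges crossed by the stretches, and [ell] gives the
    longest one of each stretch. *)
Theorem treat_pair_run : let r := treat_pair ell H lgr As D x y in
  (exists2 g, r.2 = Some g & longest_sep lgr E B g x y) /\ r.1 <= m ^ 9.
Proof.
have [_ _ le_EJ costJ] := EJ_run le_VJ2 le_VJU.
have le_VJ : size VJ <= n.
  by apply: leq_trans le_VJ2; rewrite size_VJ leq_pmulr// addn2.
have keysVJ u v : adjJ EJ u v -> v \in map fst VJ by move=> /adj_linked[].
have key0 : 0 \in map fst VJ by rewrite inE eqxx.
pose last_step o := if o is Some p then longest_on ell lgr p else op None.
have -> : treat_pair ell H lgr As D x y = (1 + ((build_J H VJ D).1 +
    ((search VJ EJ).1 + (last_step (search VJ EJ).2).1)), (last_step (search VJ EJ).2).2).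
  by [].
have := search_run le_nm le_EJ le_VJ keysVJ key0.
move: (build_J H VJ D).1 costJ (search VJ EJ) => costJ le_costJ [cost [q|]];
  rewrite /last_step /= => -[+ le_cost]; last first.
  by case=> Z [Z0 Z1 Zcl]; case/negP: Z1; apply: J_connected.
case=> ns ind.
have qE e : In e q -> In e EJ.
  elim: ind => // u {}q {}ns' e' v _ IH e'E _ _ _ [<-//|/IH//].
have ell_e e : In e q -> [/\ crosses (ell (sigma1 e) (sigma2 e)) e,
    ell (sigma1 e) (sigma2 e) \in B & forall h, crosses h e ->
      h != ell (sigma1 e) (sigma2 e) -> lgr (ell (sigma1 e) (sigma2 e)) h].
  move=> /qE/EJP[[iV jV ij _] [s1 s2 s12]].
  have [||| gT gs gmax] := @ellP (sigma1 e) (sigma2 e).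
  - apply: contraNneq ij => s12E; rewrite s12E in s1.
    by apply/eqP; apply: points_inj iV jV s1 s2.
  - exact: points_X s1.
  - exact: points_X s2.
  have gB := sep_sub BET gs; split=> //; first exact: sep_mem s12 gB.
  move=> h hs; apply: gmax; last exact: sep_ext aT BET s12 hs.
  by apply: BET; apply: sep_mem s12 hs.
have [| + cost_l] := @longest_on_run _ ell lgr ET lgr_trans lgr_total q.
  by move=> e /ell_e[_ /BET].
have m5 : 5 <= m by lia.
have le_q : size q <= n := leq_trans (induced_size ind) le_VJ.
have le_l : (longest_on ell lgr q).1 <= m ^ 2.
  apply: leq_trans cost_l _; apply: (@loop_power n m (size q) 2 1) => //; lia.
case lq: (longest_on ell lgr q).2 => [g|]; last first.
  by move=> q0; rewrite q0 in ind; inversion ind.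
case=> e eq [gE gmax]; split; last first.
  have := power_mono m5 (isT : 2 <= 8); have := power_mono m5 (isT : 7 <= 8).
  have : 1 <= m ^ 8 by rewrite expn_gt0; lia.
  move=> ? ? ?; apply: sum_power => //; lia.
exists g => //; have [ge gB emax] := ell_e _ eq; rewrite -gE in ge gB emax.
split=> //; first by have [_] := induced_crosses ind gB y1; apply; exists e.
move=> h hB hs hg; have [h0 _] := induced_crosses ind hB y1.
have [e' e'q he'] : exists2 e', In e' q & crosses h e'.
  by apply: NNPP => none; apply: hs; apply: h0 => e' e'q he'; apply: none; exists e'.
have [_ _ e'max] := ell_e _ e'q; have := e'max h he'; have := gmax _ e'q.
set g' := ell _ _; move=> gg' g'h.
have [hg'|hg'] := eqVneq h g'; first by rewrite hg'; apply: gg'; rewrite -hg'.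
have [<-|g'g] := eqVneq g' g; first exact: g'h.
exact: lgr_trans (gg' g'g) (g'h hg').
Qed.

End Pair.

(** * The whole run *)

Section Run.
Variables (P : choiceType) (X : {fset P}) (T : graph P).
Variables (ell : P -> P -> edge P) (H : edge P -> P -> P -> bool) (lgr : rel (edge P)).
Variable le : edge P -> edge P -> Prop.
Let ET := edges T.
Hypotheses (nodesT : nodes T = X) (spT : spanning X ET).
Hypotheses (lgr_trans : transitive lgr) (lgr_irr : irreflexive lgr)
  (lgr_total : {in ET &, forall e f, e != f -> lgr e f || lgr f e}).
Hypotheses (lgr_le : forall g h, lgr g h -> le h g)
  (le_trans : forall f g h, le f g -> le g h -> le f h) (lightT : light X le ET ET).
Hypothesis ellP : forall x y, x != y -> x \in X -> y \in X ->
  longest_sep lgr ET ET (ell x y) x y.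
Hypothesis HP : forall e x y, e \in ET -> x \in X -> y \in X ->
  H e x y <-> sep ET e x y.

Variables (Fs : seq (listing P)) (s : nat).

(** The terminals of this component are the node of [J] numbered [j]; numbers 0
    and 1 are taken by the pair under treatment. *)
Definition Jcomponent j := graph_of (nth ([::], [::]) Fs (j - 2)).
Let Nd j := nodes (Jcomponent j).
Let Ed j := edges (Jcomponent j).
Let numbered j := 1 < j < size Fs + 2.

Hypothesis spN : forall j, numbered j -> spanning (Nd j) (Ed j).
Hypothesis Nd_inj : forall i j z, numbered i -> numbered j ->
  z \in Nd i -> z \in Nd j -> i = j.
Hypothesis Ed_new : forall j e, numbered j -> e \in Ed j -> e \notin ET.
Hypothesis meetN : forall j, numbered j -> X `&` Nd j != fset0.
Hypothesis le_t : size Fs <= s.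
Hypothesis le_size : forall r, r < size Fs ->
  size (nth ([::], [::]) Fs r).1 <= s /\ size (nth ([::], [::]) Fs r).2 <= s.

(* No list looped over exceeds n: J has at most s + 2 nodes, hence (s + 2)^2
   edges, and each iteration adds at most s^2 edges to the deleted ones. *)
Let n := (s + 2) * (s + 2) * (s + 2).
Let m := n + 5.

Let le_nm : n + 5 <= m. Proof. by []. Qed.
Let le_sn : s <= n. Proof. by rewrite /n; nia. Qed.
Let le_s2n i j : i <= s -> j <= s -> (i + 2) * (j + 2) <= n.
Proof. by rewrite /n; nia. Qed.
Let le_s3n i j k : i <= s -> j <= s -> k <= s -> i * (j * k) <= n.
Proof.
move=> li lj lk; have : j * k <= s * s by rewrite leq_mul.
by move=> /(leq_mul li); rewrite /n; nia.
Qed.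
Let n_gt0 : 0 < n. Proof. by rewrite /n; nia. Qed.
Let m5 : 5 <= m. Proof. by rewrite /m; lia. Qed.

Let rest (D : seq (edge P)) := ET `\` [fset e in D].

Lemma terminals_of_run (vs : seq P) : let r := terminals_of X vs in
  [/\ forall v, v \in r.2 <-> v \in X /\ v \in vs, size r.2 <= size vs
    & r.1 <= (size vs * 3).+1].
Proof.
pose I (t A : seq P) := (forall v, v \in A <-> v \in X /\ v \in t) /\ size A <= size t.
have [||[vE sz] cost] := @for_each_run _ _ I 1
  (fun v A => op (if v \in X then v :: A else A)) vs [::]; last by split.
  by split=> // v; split=> // -[].
move=> s1 a s2 A _ [vE sz]; split=> //=; split; last first.
  by rewrite size_rcons; case: ifP => _ /=; lia.
move=> v; rewrite mem_rcons inE; case: ifP => aX.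
  rewrite inE; split=> [/orP[/eqP->|/vE[-> ->]]|[vX /orP[/eqP->|vs1]]];
    rewrite ?eqxx ?orbT//.
  by apply/orP; right; apply/vE.
rewrite vE; split=> [[-> ->]|[vX /orP[/eqP va|->]]]; rewrite ?orbT//.
by rewrite va aX in vX.
Qed.

Lemma update_tree_run (Fi : listing P) D (G : graph P) : let r := update_tree Fi D G in
  [/\ forall v, v \in nodes r.2 <-> v \in nodes G \/ v \in Fi.1,
      forall e, e \in edges r.2 <-> (e \in edges G \/ e \in Fi.2) /\ e \notin D
    & r.1 <= (size Fi.1 + size Fi.2 + size D) * 3 + 3].
Proof.
rewrite /update_tree /bind /=.
set f1 := (fun v G => op (add_node v G)); set f2 := (fun e G => op (add_edge e G)).
set f3 := (fun e G => op (del_edge e G)).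
pose Faddn := foldl (fun (b : graph P) a => add_node a b).
have addn (t : seq P) (G0 : graph P) :
    (forall v, v \in nodes (Faddn G0 t) <-> v \in nodes G0 \/ v \in t) /\
    edges (Faddn G0 t) = edges G0.
  elim: t G0 => [|a t IH] G0 /=; first by split=> // v; split=> [|[]]; auto.
  have [IH1 ->] := IH (add_node a G0); split=> // v; rewrite IH1 /= in_fset1U inE.
  by split=> [[/orP[->|]|->]|[->|/orP[->|]]]; rewrite ?orbT; auto.
pose Fadde := foldl (fun (b : graph P) a => add_edge a b).
have adde (t : seq (edge P)) (G0 : graph P) :
    (forall e, e \in edges (Fadde G0 t) <-> e \in edges G0 \/ e \in t) /\
    nodes (Fadde G0 t) = nodes G0.
  elim: t G0 => [|a t IH] G0 /=; first by split=> // v; split=> [|[]]; auto.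
  have [IH1 ->] := IH (add_edge a G0); split=> // v; rewrite IH1 /= in_fset1U inE.
  by split=> [[/orP[->|]|->]|[->|/orP[->|]]]; rewrite ?orbT; auto.
pose Fdele := foldl (fun (b : graph P) a => del_edge a b).
have dele (t : seq (edge P)) (G0 : graph P) :
    (forall e, e \in edges (Fdele G0 t) <-> e \in edges G0 /\ e \notin t) /\
    nodes (Fdele G0 t) = nodes G0.
  elim: t G0 => [|a t IH] G0 /=; first by split=> // v; split=> [|[]]; auto.
  have [IH1 ->] := IH (del_edge a G0); split=> // v; rewrite IH1 /= in_fsetD1 inE negb_or.
  by split=> [[/andP[-> ->] ->]|[-> /andP[-> ->]]].
set G1 := for_each Fi.1 f1 G; set G2 := for_each Fi.2 f2 G1.2.
set G3 := for_each D f3 G2.2.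
have [E1 c1] : G1.2 = Faddn G Fi.1 /\ G1.1 <= (size Fi.1 * 3).+1 := for_each_op _ _ _.
have [E2 c2] : G2.2 = Fadde G1.2 Fi.2 /\ G2.1 <= (size Fi.2 * 3).+1 := for_each_op _ _ _.
have [E3 c3] : G3.2 = Fdele G2.2 D /\ G3.1 <= (size D * 3).+1 := for_each_op _ _ _.
split; last first.
- by lia.
- by move=> e; rewrite E3 (dele _ _).1 E2 (adde _ _).1 E1 (addn _ _).2.
- by move=> v; rewrite E3 (dele _ _).2 E2 (adde _ _).2 E1; apply: (addn _ _).1.
Qed.

(* The next component will receive the number r + 2, since idx starts at 1 and a
   component is numbered one above it. *)
Let inv r (st : state P) :=
  let js := map fst (prevA st) in
  [/\ idx st = r.+1,
      [/\ forall j, j \in js <-> 1 < j < r + 2, size (prevA st) = r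
        & forall U, In U (prevA st) ->
          [/\ 1 < U.1, U.2 =i X `&` Nd U.1 & size U.2 <= s]],
      {subset delD st <= ET} /\ size (delD st) <= r * (s * s),
      [/\ forall v, v \in nodes (curT st) <-> v \in X \/ exists2 j, j \in js & v \in Nd j
        & forall e, e \in edges (curT st) <->
            e \in rest (delD st) \/ exists2 j, j \in js & e \in Ed j]
    & spanning (nodes (curT st)) (edges (curT st)) /\
      light X le (edges (curT st)) (rest (delD st))].

Section Pairs.
Variables (st : state P) (r : nat) (A : seq P).
Hypotheses (st_inv : inv r st) (rt : r < size Fs).
Hypotheses (A_ok : forall v, v \in A <-> v \in X /\ v \in Nd r.+2) (le_A : size A <= s).
Let E := edges (curT st).
Let B := rest (delD st).

Lemma treat_pairs_run : let L := treat_pairs ell H lgr (prevA st) (delD st) A in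
  [/\ forall g, g \in L.2 -> exists a b, [/\ a \in A, b \in A & longest_sep lgr E B g a b],
      forall a b, a \in A -> b \in A -> a != b ->
        exists2 g, g \in L.2 & longest_sep lgr E B g a b,
      size L.2 <= s * s & L.1 <= m ^ 12].
Proof.
have [_ [jsE szA Aok] [DT szD] [nE eE] [spE _]] := st_inv.
have js_num j : j \in map fst (prevA st) -> numbered j.
  by move=> /jsE; rewrite /numbered; lia.
have new v j : v \in A -> j \in map fst (prevA st) -> v \notin Nd j.
  move=> /A_ok[_ vN] jj; apply/negP => vNj.
  have jn := js_num _ jj; have rn : numbered r.+2 by rewrite /numbered; lia.
  by have jr := Nd_inj jn rn vNj vN; move/jsE: jj; lia.
have le_D : size (delD st) <= n.
  by apply: leq_trans szD _; apply: le_s3n => //; lia.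
have pair x y : x \in A -> y \in A -> x != y ->
    let r := treat_pair ell H lgr (prevA st) (delD st) x y in
    (exists2 g, r.2 = Some g & longest_sep lgr E B g x y) /\ r.1 <= m ^ 9.
  move=> xA yA xy; have [xX xN] := (A_ok _).1 xA; have [yX yN] := (A_ok _).1 yA.
  have [aE _ cE] := spE.
  apply: (@treat_pair_run _ X ET ell H lgr spT lgr_trans lgr_total ellP HP Nd Ed
    (prevA st) (delD st) E x y _ _ _ _ DT eE aE) le_nm le_D n_gt0 _ _ => //.
  - by move=> U /Aok[].
  - by move=> j /js_num/spN.
  - by move=> i j z /js_num ij /js_num jj; apply: Nd_inj.
  - by move=> j e /js_num jj; apply: Ed_new.
  - by apply: cE; apply/nE; left.
  - by move=> j; apply: new.
  - by move=> j; apply: new.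
  - by rewrite szA; apply: le_s2n; lia.
  - by move=> U /Aok[_ _ /leq_trans]; apply.
pose g x y := if x != y then (treat_pair ell H lgr (prevA st) (delD st) x y).2 else None.
set f := (fun x y L => if x != y then
      let* r := treat_pair ell H lgr (prevA st) (delD st) x y in
      op (if r is Some e then e :: L else L)
    else op L).
have [|LE sz cost] := @collect_run _ _ _ f g (m ^ 10) A A.
  move=> x y L /InP xA /InP yA; rewrite /f /g; case: ifP => xy; last first.
    by split=> //=; rewrite expn_gt0; lia.
  have [_] := pair _ _ xA yA xy.
  move: (treat_pair _ _ _ _ _ _ _) => res le_c; rewrite /bind /=.
  split; first by case: (res.2).
  have : 1 <= m ^ 9 by rewrite expn_gt0; lia.
  by move=> ?; apply: (sum_power m5); lia.
have le_An := leq_trans le_A le_sn.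
split.
- move=> e /InP /LE[a [b [/InP aA /InP bA]]]; rewrite /g; case: ifP => // ab gE.
  exists a, b; split=> //; have [[e' + ls] _] := pair _ _ aA bA ab.
  by rewrite gE => -[->].
- move=> a b aA bA ab; have [[e' eE' ls] _] := pair _ _ aA bA ab.
  exists e' => //; apply/InP/LE; exists a, b; split; try exact/InP.
  by rewrite /g ab.
- by apply: leq_trans sz _; rewrite leq_mul.
- apply: leq_trans cost _; apply: (loop_power le_nm le_An) => //.
  by apply: (loop_power (c := m ^ 10) le_nm le_An).
Qed.

End Pairs.

Lemma iteration_run r st : inv r st -> r < size Fs ->
  let st' := iteration X ell H lgr (nth ([::], [::]) Fs r) st in
  inv r.+1 st'.2 /\ st'.1 <= m ^ 13.
Proof.
move=> st_inv rt; set Fr := nth _ _ _.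
have [le_N le_E] := le_size rt; rewrite -/Fr in le_N le_E.
have rn : numbered r.+2 by rewrite /numbered; lia.
have NdE v : v \in Nd r.+2 <-> v \in Fr.1.
  by rewrite /Nd /Jcomponent (_ : r.+2 - 2 = r) ?inE//; lia.
have EdE e : e \in Ed r.+2 <-> e \in Fr.2.
  by rewrite /Ed /Jcomponent (_ : r.+2 - 2 = r) ?inE//; lia.
set tA := terminals_of X Fr.1.
set tL := treat_pairs ell H lgr (prevA st) (delD st) tA.2.
set tD := for_each tL.2 (fun e D => op (e :: D)) (delD st).
set tG := update_tree Fr tD.2 (curT st).
have -> : iteration X ell H lgr Fr st = (tA.1 + (tL.1 + (tD.1 + (tG.1 + 1))),
  MkState (idx st).+1 (((idx st).+1, tA.2) :: prevA st) tD.2 tG.2) by [].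
have [AE szA costA] := terminals_of_run Fr.1; rewrite -/tA in AE szA costA.
have A_ok v : v \in tA.2 <-> v \in X /\ v \in Nd r.+2 by rewrite AE NdE.
have [|L_sep sep_L szL costL] := treat_pairs_run st_inv rt A_ok; first exact: leq_trans le_N.
rewrite -/tL in L_sep sep_L szL costL.
have [idE [jsE szJ Aok] [DT szD] [nE eE] [spE lightE]] := st_inv.
have [DE costD] : tD.2 = catrev tL.2 (delD st) /\ tD.1 <= (size tL.2 * 3).+1.
  by have [-> le_c] := for_each_op cons tL.2 (delD st); split=> //; elim: (tL.2) (delD st) => /=.
have memD e : (e \in tD.2) = (e \in tL.2) || (e \in delD st).
  by rewrite DE catrevE mem_cat mem_rev.
have szD' : size tD.2 <= r.+1 * (s * s).
  by rewrite DE catrevE size_cat size_rev mulSn leq_add.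
have [nG eG costG] := update_tree_run Fr tD.2 (curT st); rewrite -/tG in nG eG costG.
clearbody tG.
set V := nodes (curT st); set E := edges (curT st); set B := rest (delD st).
set L := [fset e in tL.2].
have memL e : (e \in L) = (e \in tL.2) by rewrite inE.
have js_num j : j \in map fst (prevA st) -> numbered j.
  by move=> /jsE; rewrite /numbered; lia.
have XV : {subset X <= V} by move=> v vX; apply/nE; left.
have meetE : V `&` Nd r.+2 = X `&` Nd r.+2.
  apply/fsetP => v; rewrite !in_fsetI; case vN: (v \in Nd r.+2); rewrite ?andbF// !andbT.
  apply/idP/idP => [/nE[//|[j jj vNj]]|/XV//].
  have jr := Nd_inj (js_num _ jj) rn vNj vN; move/jsE: jj; lia.
have meetA v : v \in V `&` Nd r.+2 <-> v \in tA.2.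
  by rewrite meetE A_ok in_fsetI; split=> /andP.
have BE : {subset B <= E} by move=> e eB; apply/eE; left.
have meet0 : V `&` Nd r.+2 != fset0 by rewrite meetE meetN.
have L_sep' g : g \in L -> exists a b, [/\ a \in V `&` Nd r.+2, b \in V `&` Nd r.+2
    & longest_sep lgr E B g a b].
  by rewrite inE => /L_sep[a [b [/meetA aA /meetA bA ls]]]; exists a, b.
have sep_L' a b : a \in V `&` Nd r.+2 -> b \in V `&` Nd r.+2 -> a != b ->
    exists2 g, g \in L & longest_sep lgr E B g a b.
  by move=> /meetA aA /meetA bA ab; have [g gL ls] := sep_L _ _ aA bA ab;
    exists g => //; rewrite inE.
have EdB e : e \in B -> e \notin Ed r.+2.
  move=> eB; apply/negP => /(Ed_new rn); rewrite (_ : e \in ET)//.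
  by move: eB; rewrite inE => /andP[].
have spJ := joined_spanning lgr_trans lgr_irr spE BE (spN rn) meet0 L_sep' sep_L'.
have ltJ := joined_light lgr_trans lgr_irr spE BE (spN rn) meet0 L_sep' sep_L'
  XV lgr_le le_trans EdB lightE.
have LT g : g \in L -> g \in ET.
  by move=> /L_sep'[a [b [_ _ [+ _ _]]]]; rewrite inE => /andP[].
have restE : rest tD.2 = B `\` L.
  by apply/fsetP => e; rewrite !inE memD negb_or andbA.
have VE : nodes tG.2 = V `|` Nd r.+2.
  apply/fsetP => v; rewrite in_fsetU; apply/idP/orP => [/nG|] [vV|vN]; try by auto.
  - by right; apply/NdE.
  - by apply/nG; left.
  - by apply/nG; right; apply/NdE.
have EE : edges tG.2 = joined_tree E (Ed r.+2) L.
  apply/fsetP => e; rewrite /joined_tree in_fsetU in_fsetD memL.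
  apply/idP/orP => [/eG[eEF]|].
    rewrite memD negb_or => /andP[eL eD]; case: eEF => [eE'|/EdE]; last by auto.
    by left; rewrite eL.
  case=> [/andP[eL eE']|eF]; apply/eG.
    split; first by left.
    rewrite memD (negPf eL) /=; apply/negP => eD; move/eE: (eE') => [|[j jj eEd]].
      by rewrite !inE eD.
    by have := Ed_new (js_num _ jj) eEd; rewrite DT.
  split; first by right; apply/EdE.
  apply/negP; rewrite memD => eLD; have := Ed_new rn eF.
  by case/orP: eLD => [eL|/DT->]//; rewrite LT// inE.
split; last first.
  have le1 : 1 <= m ^ 12 by rewrite expn_gt0; lia.
  have le2 := power_mono m5 (isT : 2 <= 12); have le3 := power_mono m5 (isT : 3 <= 12).
  have cA : tA.1 <= m ^ 12.
    apply: leq_trans (leq_trans costA _) le2.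
    apply: (@loop_power n m (size Fr.1) 1 1) => //; [exact: leq_trans le_N le_sn|lia].
  have cD : tD.1 <= m ^ 12.
    apply: leq_trans (leq_trans costD _) le2.
    apply: (@loop_power n m (size tL.2) 1 1) => //; last lia.
    by apply: leq_trans szL _; rewrite -[s * s]mul1n; nia.
  have cG : tG.1 <= m ^ 12.
    apply: leq_trans (leq_trans costG _) le3.
    have : size tD.2 <= n by apply: leq_trans szD' (le_s3n _ _ _); lia.
    move=> le_D; have := power_mono m5 (isT : 2 <= 3); rewrite -mulnn.
    by move: (m ^ 3) => M; rewrite /m; nia.
  apply: (sum_power m5); rewrite [_.1]/=.
  by move: (m ^ 12) cA costL cD cG le1 => M; lia.
split=> /=.
- by rewrite idE.
- split.
  + move=> j; rewrite inE; split=> [/orP[/eqP->|/jsE]|]; rewrite ?idE; try lia.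
    by move=> jr; apply/orP; case: (ltngtP j r.+2) => jr2; [right; apply/jsE|..]; try lia; left.
  + by rewrite szJ.
  + move=> U [<-|/Aok//] /=; rewrite idE; split=> //; last exact: leq_trans szA le_N.
    by move=> v; rewrite in_fsetI; apply/idP/andP => /A_ok.
- split=> //; move=> e; rewrite memD => /orP[eL|/DT//]; apply: LT.
  by rewrite inE.
- split.
  + move=> v; rewrite VE in_fsetU idE; split=> [/orP[/nE[|[j jj vN]]|vN]|]; first by auto.
    * by right; exists j => //; rewrite inE jj orbT.
    * by right; exists r.+2 => //; rewrite inE eqxx.
    case=> [/XV->//|[j]]; rewrite inE => /orP[/eqP->->|jj vN]; first by rewrite orbT.
    by apply/orP; left; apply/nE; right; exists j.
  + move=> e; rewrite EE /joined_tree restE in_fsetU idE; split=> [/orP[|eF]|].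
    * rewrite inE => /andP[eL /eE[eB|[j jj eEd]]].
        by left; rewrite inE eL.
      by right; exists j => //; rewrite inE jj orbT.
    * by right; exists r.+2 => //; rewrite inE eqxx.
    case=> [/fsetDP[/BE eE' eL]|[j]]; first by rewrite in_fsetD eL eE'.
    rewrite in_cons => /orP[/eqP->->|jj eEd]; first by rewrite orbT.
    apply/orP; left; rewrite in_fsetD; apply/andP; split; last by apply/eE; right; exists j.
    by apply: contraNN (Ed_new (js_num _ jj) eEd); apply: LT.
- by rewrite VE EE restE.
Qed.

Theorem F_MST_run : let r := F_MST X T ell H lgr Fs in
  exists D : {fset edge P},
  [/\ forall v, v \in nodes r.2 <-> v \in X \/ exists2 j, numbered j & v \in Nd j,
      forall e, e \in edges r.2 <->
        e \in ET `\` D \/ exists2 j, numbered j & e \in Ed j,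
      spanning (nodes r.2) (edges r.2), light X le (edges r.2) (ET `\` D)
    & r.1 <= m ^ 15].
Proof.
pose body := iteration X ell H lgr.
have [||] := @for_each_run _ _ (fun s1 => inv (size s1)) (m ^ 13) body Fs
    (MkState 1 [::] [::] T).
- split=> //=.
  + by split=> // j; split=> //; lia.
  + split=> [v|e]; first by rewrite nodesT; split=> [|[|[]]//]; auto.
    by rewrite !inE /=; split=> [|[|[]]//]; auto.
  + rewrite nodesT; split=> //.
    move=> x y e xX yX; rewrite inE => /andP[_]; exact: lightT.
- move=> s1 Fi s2 st FsE Ist; rewrite size_rcons.
  have rt : size s1 < size Fs by rewrite FsE size_cat /=; lia.
  have FiE : nth ([::], [::]) Fs (size s1) = Fi by rewrite FsE nth_cat ltnn subnn.
  by have := iteration_run Ist rt; rewrite FiE.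
set res := for_each _ _ _ => -[_ [jsE _ _] _ [nE eE] [sp lt]] cost r.
have rE : r = (res.1 + 1, curT res.2) by [].
have jsN j : j \in map fst (prevA res.2) <-> numbered j by rewrite jsE.
exists [fset e in delD res.2]; rewrite rE; split=> //=.
- by move=> v; rewrite nE; split=> -[|[j /jsN]]; eauto.
- by move=> e; rewrite eE; split=> -[|[j /jsN]]; eauto.
have cost' : res.1 <= m ^ 14.
  by apply: leq_trans cost (loop_power le_nm (leq_trans le_t le_sn) _ _).
have : 1 <= m ^ 14 by rewrite expn_gt0; lia.
by move=> ?; apply: (sum_power m5); lia.
Qed.

End Run.

(** * Viable forests and their components *)

Section Components.
Variables (P : choiceType) (F : graph P).
Hypothesis fF : is_forest F.
Implicit Types (C : graph P) (x y z : P).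

Let sF : simple_graph F. Proof. by case: fF. Qed.

Let aF : acyclic (edges F). Proof. by apply/is_forestP. Qed.

Lemma forest_edge u v : [fset u; v] \in edges F -> u \in nodes F /\ v \in nodes F.
Proof.
move=> uv; have [a [b [_ ab aN bN]]] := sF uv.
by case: (fset2_eq ab) => [][-> ->].
Qed.

Lemma joinedP x y : x \in nodes F -> joined F x y <-> conn (edges F) x y.
Proof.
move=> xF; split=> [[_ _ [p /path_conn_all + <-]]//|xy].
have pF : pairs_of (nodes F) (edges F) by move=> e /sF[u [v [_ eE uV vV]]]; exists u, v.
split=> //; first exact: conn_in pF xy xF.
by have [p [pth _ lp]] := conn_path xy; exists p.
Qed.

Lemma component_edge C u v : is_component F C -> [fset u; v] \in edges F ->
  u \in nodes C -> v \in nodes C /\ [fset u; v] \in edges C.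
Proof.
move=> [x xF [Cx CE]] uv uC; have xu := (joinedP _ xF).1 ((Cx _).1 uC).
have vC : v \in nodes C.
  by apply/Cx/(joinedP _ xF); apply: conn_trans xu (conn1 uv).
split=> //; rewrite CE !inE uv /=; apply/fsubsetP => z.
by rewrite !inE => /orP[]/eqP->.
Qed.

Lemma component_sub C : is_component F C ->
  {subset nodes C <= nodes F} /\ {subset edges C <= edges F}.
Proof.
move=> [x xF [Cx CE]]; split=> [z /Cx[]//|e].
by rewrite CE !inE => /andP[].
Qed.

Lemma component_spanning C : is_component F C -> spanning (nodes C) (edges C).
Proof.
move=> isC; have [nsub esub] := component_sub isC.
have [x xF [Cx CE]] := isC.
split; first exact: acyclic_sub aF.
  move=> e eC; have [u [v [_ eE _ _]]] := sF (esub _ eC); exists u, v.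
  by move: eC; rewrite CE !inE => /andP[_ /fsubsetP sub]; split=> //;
    apply: sub; rewrite eE !inE eqxx ?orbT.
have xC : x \in nodes C by apply/Cx/(joinedP _ xF); apply: conn_refl.
have fromx z : z \in nodes C -> conn (edges C) x z.
  move=> /Cx/(joinedP _ xF) xz.
  suff [] : z \in nodes C /\ conn (edges C) x z by [].
  apply: (conn_closed (C := fun z => z \in nodes C /\ conn (edges C) x z)) xz _.
    move=> u v uv [uC xu]; have [vC uvC] := component_edge isC uv uC.
    by split=> //; apply: conn_trans xu (conn1 uvC).
  by split=> //; apply: conn_refl.
by move=> u v /fromx xu /fromx xv; apply: conn_trans (conn_sym xu) xv.
Qed.

Lemma component_inj C C' z : is_component F C -> is_component F C' ->
  z \in nodes C -> z \in nodes C' -> C = C'.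
Proof.
have nsub D D' : is_component F D -> is_component F D' ->
    z \in nodes D -> z \in nodes D' -> {subset nodes D <= nodes D'}.
  move=> [x xF [Dx _]] [x' xF' [Dx' _]] /Dx/(joinedP _ xF) xz /Dx'/(joinedP _ xF') xz'.
  move=> y /Dx/(joinedP _ xF) xy; apply/Dx'/(joinedP _ xF').
  exact: conn_trans xz' (conn_trans (conn_sym xz) xy).
move=> isC isC' zC zC'.
have nE : nodes C = nodes C'.
  by apply/fsetP => v; apply/idP/idP; apply: nsub.
have [_ _ [_ CE]] := isC; have [_ _ [_ CE']] := isC'.
rewrite nE -CE' in CE; case: C C' nE CE {isC isC' zC zC' CE'} => V E [V' E'] /=.
by rewrite /nodes /edges /= => -> ->.
Qed.

Lemma component_exists x : x \in nodes F -> exists2 C, is_component F C & x \in nodes C.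
Proof.
move=> xF; pose V := [fset y in nodes F | boolp.asbool (joined F x y)].
have VE y : y \in V <-> joined F x y.
  by rewrite !inE; split=> [/andP[_ /boolp.asboolP]//|xy]; apply/andP; split;
    [case: xy|apply/boolp.asboolP].
exists (V, [fset e in edges F | e `<=` V]); first by exists x.
by apply/VE/(joinedP _ xF); apply: conn_refl.
Qed.

End Components.

Section Viable.
Variables (P : choiceType) (X : {fset P}) (k : nat) (F : graph P).
Hypotheses (vF : viable X k F) (stF : steiner_in_components X F).

Let fF : is_forest F. Proof. by case: vF. Qed.

Lemma nbhdE (G : graph P) u v : v \in nbhd G u = (v \in nodes G) && ([fset u; v] \in edges G).
Proof. by rewrite !inE. Qed.

Lemma terminal_degree u : u \in nodes F -> u \in X -> degree F u = 1.
Proof.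
move=> uF uX; have [_ _ _ lv _] := vF.
have : u \in leaves F by rewrite lv inE uF.
by rewrite !inE => /andP[_ /eqP].
Qed.

Lemma terminal_nbhd u v : [fset u; v] \in edges F -> u \in X -> nbhd F u = [fset v].
Proof.
move=> uv uX; have [uF vF'] := forest_edge fF uv.
have /eqP/cardfs1P[w wE] := terminal_degree uF uX.
have : v \in nbhd F u by rewrite nbhdE vF'.
by rewrite wE inE => /eqP->.
Qed.

(** Terminals are leaves, so an edge joining two of them would be a whole
    component. *)
Lemma edge_steiner e : e \in edges F -> exists s v,
  [/\ e = [fset s; v], s \in steiner X F & v \in nbhd F s].
Proof.
move=> eF; have [u [v [uv eE uF vF']]] := fF.1 _ eF; subst e.
have [uX|uX] := boolP (u \in X); last first.
  by exists u, v; rewrite nbhdE vF' !inE uX uF.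
have vu : [fset v; u] \in edges F by rewrite fsetUC.
have [vX|vX] := boolP (v \in X); last first.
  by exists v, u; split; rewrite ?nbhdE ?uF// ?inE ?vX// fsetUC.
have uN := terminal_nbhd eF uX; have vN := terminal_nbhd vu vX.
have [C isC uC] := component_exists fF uF; have [s sS sC] := stF isC.
have [_ _ cC] := component_spanning fF isC.
have us : conn (edges F) u s.
  by apply: conn_sub (cC _ _ uC sC); apply: (component_sub isC).2.
suff : s \in X by move: sS; rewrite inE => /andP[/negPf->].
have : s \in [fset u; v].
  apply: (conn_closed (C := fun z => z \in [fset u; v])) us _; last by rewrite !inE eqxx.
  move=> a b ab; rewrite !inE => /orP[]/eqP aE; subst a.
    have : b \in nbhd F u by rewrite nbhdE ab (forest_edge fF ab).2.
    by rewrite uN inE => /eqP->; rewrite eqxx orbT.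
  have : b \in nbhd F v by rewrite nbhdE ab (forest_edge fF ab).2.
  by rewrite vN inE => /eqP->; rewrite eqxx.
by rewrite !inE => /orP[]/eqP->.
Qed.

(** Otherwise all nodes of the component are Steiner points, of degree at least
    two, while a finite forest has a point of degree at most one. *)
Lemma component_terminal C : is_component F C -> X `&` nodes C != fset0.
Proof.
move=> isC; apply/negP => /eqP XC.
have [aC _ _] := component_spanning fF isC; have [nsub esub] := component_sub isC.
have [_ _ deg2 _ _] := vF.
have C0 : nodes C != fset0 by have [s _ sC] := stF isC; apply/fset0Pn; exists s.
apply: (acyclic_leaf aC C0) => x xC.
have xS : x \in steiner X F.
  rewrite inE nsub// andbT; apply/negP => xX.
  by have : x \in X `&` nodes C; [rewrite inE xX|rewrite XC inE].
have := deg2 _ xS; rewrite /degree => d2.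
have [y yN] : exists y, y \in nbhd F x by apply/fset0Pn; rewrite -cardfs_gt0; lia.
have [z] : exists z, z \in nbhd F x `\ y.
  by apply/fset0Pn; rewrite -cardfs_gt0; move: d2; rewrite (cardfsD1 y) yN; lia.
rewrite in_fsetD1 => /andP[zy zN]; exists y, z.
move: yN zN; rewrite !nbhdE => /andP[_ xy] /andP[_ xz].
have [yC xyC] := component_edge fF isC xy xC; have [zC xzC] := component_edge fF isC xz xC.
by split=> //; rewrite eq_sym.
Qed.

Lemma size_flatten_le (A B : Type) (f : A -> seq B) d t :
  (forall a, In a t -> size (f a) <= d) -> size (flatten (map f t)) <= d * size t.
Proof.
elim: t => //= a t IH le_d; rewrite size_cat mulnS leq_add//; first by apply: le_d; left.
by apply: IH => b bt; apply: le_d; right.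
Qed.

Lemma viable_edges : #|` edges F| <= 6 * k.
Proof.
have [_ le_k _ _ deg6] := vF.
pose t : seq (edge P) := flatten [seq [seq [fset s; v] | v <- nbhd F s] | s <- steiner X F].
apply: (@leq_trans (size t)).
  apply: uniq_leq_size; first exact: fset_uniq.
  move=> e /edge_steiner[s [v [-> sS vs]]]; apply/flattenP.
  by exists [seq [fset s; v] | v <- nbhd F s]; apply: map_f.
apply: leq_trans (size_flatten_le (d := 6) _) _; last by rewrite leq_mul2l.
by move=> s /InP sS; rewrite size_map; apply: deg6.
Qed.

(** A terminal of [F] is a leaf, so it is a neighbour of a Steiner point. *)
Lemma viable_nodes : #|` nodes F| <= 7 * k.
Proof.
have [_ le_k _ _ deg6] := vF.
pose t : seq P := enum_fset (steiner X F) ++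
  flatten [seq enum_fset (nbhd F s) | s <- steiner X F].
apply: (@leq_trans (size t)).
  apply: uniq_leq_size; first exact: fset_uniq.
  move=> v vF'; rewrite mem_cat; apply/orP.
  have [vX|vX] := boolP (v \in X); last by left; rewrite inE vX.
  right; have /eqP/cardfs1P[u uE] := terminal_degree vF' vX.
  have : u \in nbhd F v by rewrite uE inE.
  rewrite nbhdE => /andP[uF vu]; have [s [w [vuE sS ws]]] := edge_steiner vu.
  apply/flattenP; exists (enum_fset (nbhd F s)); first exact: map_f.
  case: (fset2_eq vuE) => [][vs _]; last by rewrite vs.
  by move: sS; rewrite -vs inE vX.
rewrite size_cat (_ : 7 * k = k + 6 * k); last lia.
rewrite leq_add//.
apply: leq_trans (size_flatten_le (d := 6) _) _; last by rewrite leq_mul2l.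
by move=> s /InP sS; apply: deg6.
Qed.

Variable Fs : seq (listing P).
Hypothesis lF : lists_components F Fs.

Let numbered j := 1 < j < size Fs + 2.

Lemma Jcomponent_is_component j : numbered j -> is_component F (Jcomponent Fs j).
Proof.
rewrite /numbered => jn; have lt : j - 2 < size Fs by lia.
by have [_ _ gs] := lF; apply/gs/map_f/mem_nth.
Qed.

Lemma component_numbered C : is_component F C -> exists2 j, numbered j & C = Jcomponent Fs j.
Proof.
have [_ _ gs] := lF => /gs/mapP[L LF ->]; exists (index L Fs).+2.
  by have : index L Fs < size Fs; [rewrite index_mem|rewrite /numbered; lia].
by rewrite /Jcomponent (_ : _ - 2 = index L Fs) ?nth_index//; lia.
Qed.

Lemma Jcomponent_inj i j : numbered i -> numbered j -> Jcomponent Fs i = Jcomponent Fs j -> i = j.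
Proof.
rewrite /numbered => iN jN; have [_ us _] := lF => cE.
have i2 : i - 2 < size Fs by lia.
have j2 : j - 2 < size Fs by lia.
suff : i - 2 = j - 2 by lia.
apply/eqP; rewrite -(nth_uniq (graph_of ([::], [::])) _ _ us) ?size_map//.
by rewrite !(nth_map ([::], [::]))//; apply/eqP.
Qed.

(** Each component contains a Steiner point, and a point lies in one component
    only. *)
Lemma few_components : size Fs <= k.
Proof.
have [_ us gs] := lF; have [_ le_k _ _ _] := vF; apply: leq_trans le_k.
rewrite -(size_map (@graph_of P)).
pose f s := nth (graph_of ([::], [::])) [seq graph_of L | L <- Fs]
  (find (fun C : graph P => s \in nodes C) [seq graph_of L | L <- Fs]).
rewrite -[X in _ <= X](size_map f); apply: uniq_leq_size => // C CF.
have isC := (gs C).1 CF; have [s sS sC] := stF isC.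
apply/mapP; exists s => //.
have hs : has (fun C : graph P => s \in nodes C) [seq graph_of L | L <- Fs].
  by apply/hasP; exists C.
apply: (component_inj fF isC _ sC (nth_find _ hs)).
by apply/gs/mem_nth; rewrite -has_find.
Qed.

Lemma listing_sizes r : r < size Fs ->
  size (nth ([::], [::]) Fs r).1 <= 7 * k /\ size (nth ([::], [::]) Fs r).2 <= 7 * k.
Proof.
move=> rt; have [ul _ _] := lF; have [u1 u2] := ul _ (mem_nth ([::], [::]) rt).
have rn : numbered r.+2 by rewrite /numbered; lia.
have [nsub esub] := component_sub (Jcomponent_is_component rn).
rewrite /Jcomponent (_ : r.+2 - 2 = r) in nsub esub; last by lia.
split.
  apply: leq_trans viable_nodes; apply: uniq_leq_size => // v vL.
  by apply: nsub; rewrite inE.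
apply: leq_trans (_ : 6 * k <= _); last by rewrite leq_mul2r orbT.
apply: leq_trans viable_edges; apply: uniq_leq_size => // e eL.
by apply: esub; rewrite inE.
Qed.

End Viable.

(** * Optimality and running time *)

(** For [k <= d] the power [k ^ d] is at most [d ^ d], and for larger [k] the exponent
    [2 * k + 3] exceeds [d]. *)
Lemma polynomial_cost C d : exists c, forall k, 0 < k ->
  (C * k) ^ d <= c * (k ^ (2 * k + 3) * k`!).
Proof.
exists (C ^ d * d ^ d) => k k0; rewrite expnMn -mulnA leq_mul2l; apply/orP; right.
have f1 := fact_gt0 k; have [kd|dk] := leqP k d.
  apply: (@leq_trans (d ^ d)); first by rewrite leq_exp2r//; lia.
  by rewrite leq_pmulr// muln_gt0 f1 expn_gt0 k0.
apply: (@leq_trans (k ^ (2 * k + 3))); first by rewrite leq_pexp2l//; lia.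
have d0 : 0 < d ^ d by rewrite expn_gt0; case: (d).
by apply: leq_trans (leq_pmulr _ f1) (leq_pmull _ d0).
Qed.

Section Longer.
Variables (R : realType) (nrm : 'rV[R]_2 -> R) (o : seq (edge 'rV[R]_2)).

Lemma longer_irr : irreflexive (longer nrm o).
Proof. by move=> e; rewrite /longer ltxx ltnn andbF. Qed.

Lemma longer_trans : transitive (longer nrm o).
Proof.
move=> f e g; rewrite /longer => /orP[lt1|/andP[/eqP-> i1]] /orP[lt2|/andP[/eqP<- i2]].
- by rewrite (lt_trans lt2 lt1).
- by rewrite lt1.
- by rewrite lt2.
- by rewrite eqxx (ltn_trans i1 i2) orbT.
Qed.

Lemma longer_total : {in o &, forall e f, e != f -> longer nrm o e f || longer nrm o f e}.
Proof.
move=> e f eo fo ef; rewrite /longer.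
have [//|//|_] := ltgtP (elen nrm e) (elen nrm f); rewrite ?orbT//=.
rewrite -neq_ltn; apply: contraNneq ef => ie.
by rewrite -(nth_index e eo) ie nth_index.
Qed.

Lemma longer_le e f : longer nrm o e f -> no_longer (elen nrm) f e.
Proof. by rewrite /no_longer => /orP[/ltW//|/andP[/eqP->]]. Qed.

End Longer.

Theorem theorem15 (R : realType) :
  exists c : nat,
  forall (nrm : 'rV[R]_2 -> R) (X : {fset 'rV[R]_2}) (T : graph 'rV[R]_2)
    (k : nat) (o : seq (edge 'rV[R]_2))
    (ell : 'rV[R]_2 -> 'rV[R]_2 -> edge 'rV[R]_2)
    (H : edge 'rV[R]_2 -> 'rV[R]_2 -> 'rV[R]_2 -> bool)
    (F : graph 'rV[R]_2) (Fs : seq (listing 'rV[R]_2)),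
  is_norm nrm ->
  is_mst nrm X T ->
  0 < k ->
  perm_eq o (edges T) ->
  PP1 nrm T o ell ->
  PP2 T H ->
  viable X k F ->
  steiner_in_components X F ->
  lists_components F Fs ->
  let run := F_MST X T ell H (longer nrm o) Fs in
  min_F_fixed nrm X F run.2 /\ run.1 <= c * (k ^ (2 * k + 3) * k`!).
Proof.
(* a forest with k Steiner points has at most 7 k nodes, which bounds the loops
   by m = (7 k + 2)^3 + 5 <= (16 k)^3, and the run takes at most m^15 steps *)
have [c costP] := polynomial_cost 16 45; exists c.
move=> nrm X T k o ell H F Fs _ mstT k0 oT ellT HT vF stF lF run.
have [treeT XT _] := mstT; have [spT T0 _] := (is_treeP T).1 treeT; rewrite XT in spT T0.
have [fF _ _ _ _] := vF.
have o_mem : edges T =i o by move=> e; rewrite (perm_mem oT).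
have total : {in edges T &, forall e f, e != f -> longer nrm o e f || longer nrm o f e}.
  by move=> e f; rewrite !o_mem; apply: longer_total.
have num_sub j := @Jcomponent_is_component _ F Fs lF j.
have NT j e : 1 < j < size Fs + 2 -> e \in edges (Jcomponent Fs j) -> e \notin edges T.
  move=> /num_sub isC eC; have eF := (component_sub isC).2 _ eC.
  have [s [v [-> sS _]]] := edge_steiner vF stF eF.
  have [_ pT _] := spT; apply/negP => /(pairs_ofP pT)[sX _].
  by move: sS; rewrite inE sX.
have inj i j z : 1 < i < size Fs + 2 -> 1 < j < size Fs + 2 ->
    z \in nodes (Jcomponent Fs i) -> z \in nodes (Jcomponent Fs j) -> i = j.
  move=> iN jN zi zj; apply: (Jcomponent_inj lF iN jN).
  exact: (component_inj fF (num_sub _ iN) (num_sub _ jN) zi zj).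
have ellP x y : x != y -> x \in X -> y \in X ->
    longest_sep (longer nrm o) (edges T) (edges T) (ell x y) x y.
  by move=> xy xX yX; apply: PP1_sep; rewrite ?XT.
have HP e x y : e \in edges T -> x \in X -> y \in X -> H e x y <-> sep (edges T) e x y.
  by move=> eT xX yX; apply: PP2_sep; rewrite ?XT.
have le_trans e f g : no_longer (elen nrm) e f -> no_longer (elen nrm) f g ->
    no_longer (elen nrm) e g by apply: Order.POrderTheory.le_trans.
have le_Fs : size Fs <= 7 * k.
  by apply: leq_trans (few_components vF stF lF) _; rewrite leq_pmull.
have [D [nE eE spG lightG cost]] := F_MST_run XT spT (@longer_trans _ nrm o)
  (@longer_irr _ nrm o) total (@longer_le _ nrm o) le_trans (mst_light mstT) ellP HP
  (fun j jn => component_spanning fF (num_sub j jn)) inj NT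
  (fun j jn => component_terminal vF stF (num_sub j jn)) le_Fs
  (listing_sizes vF stF lF).
rewrite -/run in nE eE spG lightG cost.
have spt := @edge_steiner _ X k F vF stF.
have nodesE : nodes run.2 = X `|` steiner X F.
  apply/fsetP => v; rewrite in_fsetU; apply/idP/orP => [/nE[|[j jn vj]]|]; first by left.
    have [vX|vX] := boolP (v \in X); first by left.
    by right; rewrite inE vX; apply: (component_sub (num_sub _ jn)).1.
  case=> [vX|]; first by apply/nE; left.
  rewrite inE => /andP[_ vN]; have [C isC vC] := component_exists fF vN.
  have [j jn CE] := component_numbered lF isC; apply/nE; right; exists j => //.
  by rewrite -CE.
have edgesE e : e \in edges run.2 <-> e \in edges T `\` D \/ e \in edges F.
  rewrite eE; split=> [[|[j jn ej]]|[|eF]]; try by left.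
    by right; apply: (component_sub (num_sub _ jn)).2.
  have [u [v [_ euv uN _]]] := fF.1 _ eF.
  have [C isC uC] := component_exists fF uN; have [j jn CE] := component_numbered lF isC.
  right; exists j => //; rewrite -CE euv.
  by apply: (component_edge fF isC _ uC).2; rewrite -euv.
have [_ pT _] := spT.
have steinerX s : s \in steiner X F -> s \notin X by rewrite inE => /andP[].
split; last first.
  apply: leq_trans (costP _ k0); rewrite (expnM _ 3 15).
  apply: leq_trans cost _; rewrite leq_exp2r//.
  by rewrite !expnS expn0; nia.
have F_run : {subset edges F <= edges run.2} by move=> e eF; apply/edgesE; right.
split.
  split=> // [|s sS].
    apply/is_treeP; split=> //.
      by case/fset0Pn: T0 => v vX; apply/fset0Pn; exists v; apply/nE; left.
    by move: (spanning_simple spG); case: (run.2).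
  apply/fsetP => v; rewrite !nbhdE; apply/andP/andP => -[vN sv].
    case/edgesE: sv => [|sv]; last by have [_ vF'] := forest_edge fF sv.
    rewrite inE => /andP[_ /(pairs_ofP pT)[sX _]].
    by have := steinerX _ sS; rewrite sX.
  split; last exact: F_run.
  rewrite nodesE !inE vN andbT; by case: (v \in X).
move=> G' [treeG' nG' nbG']; have [spG' _ _] := (is_treeP _).1 treeG'.
rewrite nG' -nodesE in spG'.
have sub0 e : e \in edges run.2 `\` edges F -> e \in edges T `\` D.
  by rewrite inE => /andP[eF /edgesE[//|]]; rewrite (negPf eF).
apply: (light_minimal (X := X) spG spG' F_run).
- move=> e /spt[s [v [-> sS]]]; rewrite -nbG'// nbhdE => /andP[] //.
- by move=> e /sub0; rewrite inE => /andP[_ /pT].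
- move=> e; rewrite inE => /andP[eF eG']; have [_ pG' _] := spG'.
  have [u [v [euv uN vN]]] := pG' _ eG'.
  have inX a b : a \in nodes run.2 -> b \in nodes run.2 -> e = [fset a; b] -> a \in X.
    move=> aN bN eab; apply/negPn/negP => aX.
    have aS : a \in steiner X F by move: aN; rewrite nodesE in_fsetU (negPf aX).
    have : b \in nbhd G' a by rewrite nbhdE -eab eG' nG' -nodesE bN.
    by rewrite nbG'// nbhdE -eab (negPf eF) andbF.
  exists u, v; split=> //; first exact: inX uN vN euv.
  by apply: inX vN uN _; rewrite euv fsetUC.
- by move=> x y e xX yX /sub0; apply: lightG.
Qed.
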